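(* Let $p$ be an odd prime and $n$ a positive integer divisible by $4$. Let $N_{\mathcal{S}}(p,n)$ be the number of pairwise non-isotopic pre-semifields of order $p^n$ in Family $\mathcal{S}$. Then $$\frac{\sigma(n)-1}{2}\cdot\frac{p^{n/4}-1}{n}\ \le\ N_{\mathcal{S}}(p,n)\ \le\ \frac{\sigma(n)-1}{2}\,\bigl(p^{n/4}-1\bigr).$$
   Context: $\sigma(n)$ denotes the odd part of $n$, i.e. $n$ divided by the largest power of $2$ dividing it. Family $\mathcal{S}$ of order $p^n$: put $m=n/2$ (even), $\mathbb{M}=\mathbb{F}_{p^m}$, $\mathbb{L}=\mathbb{F}_{p^{m/2}}$. The family consists of the commutative pre-semifields $\mathbb{P}_{q,B,a}=(\mathbb{M}\times\mathbb{M},+,\ast)$, $$(x,y)\ast(u,v)=\bigl(x^qu+xu^q+B(y^qv+yv^q),\ x^{r}v+yu^{r}+\tfrac aB(xv^{r}+y^{r}u)\bigr),$$ where $q=p^k$, $r=p^{k+m/2}$, $1\le k\le m-1$ with $m/\gcd(k,m)$ odd, $B\in\mathbb{M}^\times$ is a non-square, and $a\in\mathbb{L}^\times$. A pre-semifield is a finite additive group with a left and right distributive multiplication without zero divisors. Two pre-semifields on the same $\mathbb{F}_p$-vector space with multiplications $\circ_1,\circ_2$ are isotopic if there are $\mathbb{F}_p$-linear bijections $N,L,M$ with $N(X\circ_1U)=L(X)\circ_2M(U)$ for all $X,U$. $N_{\mathcal{S}}(p,n)$ is the number of isotopy classes containing a member of the family of order $p^n$. *)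

(* Defs.v *)
From HB Require Import structures.
From mathcomp Require Import all_boot all_order all_algebra all_fingroup.

Set Implicit Arguments.
Unset Strict Implicit.
Unset Printing Implicit Defensive.

Import GRing.Theory.
Local Open Scope ring_scope.

(* Makes the product of two finZmodTypes a finZmodType. *)
HB.saturate prod.

Definition odd_part (n : nat) : nat := (n %/ 2 ^ logn 2 n)%N.

Notation multiplication V := {ffun V * V -> V}.

Definition is_presemifield (V : finZmodType) (op : multiplication V) : bool :=
  [&& [forall X, forall Y, forall U, op (X + Y, U) == op (X, U) + op (Y, U)],
      [forall X, forall U, forall W, op (X, U + W) == op (X, U) + op (X, W)]
    & [forall X, forall U, (op (X, U) == 0) ==> (X == 0) || (U == 0)]].

(* When V has exponent p, X *+ c is the action of the scalar c : 'F_p on X. *)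
Definition Fp_linear (p : nat) (V : finZmodType) (f : V -> V) : bool :=
  [forall c : 'F_p, forall X, forall Y, f (X *+ c + Y) == f X *+ c + f Y].

Definition isotopic (p : nat) (V : finZmodType) : rel (multiplication V) :=
  fun op1 op2 =>
    [exists N : {perm V}, exists L : {perm V}, exists T : {perm V},
      [&& Fp_linear p N, Fp_linear p L, Fp_linear p T
        & [forall X, forall U, N (op1 (X, U)) == op2 (L X, T U)]]].

Definition isotopy_classes (p : nat) (V : finZmodType) :
    {set {set multiplication V}} :=
  equivalence_partition (isotopic p (V := V)) [set op | is_presemifield op].

Definition is_square (M : finFieldType) (B : M) : bool :=
  [exists c : M, B == c ^+ 2].

Definition mulS (M : finFieldType) (p m k : nat) (B a : M) :
    multiplication (M * M)%type :=
  let q := (p ^ k)%N in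
  let r := (p ^ (k + m %/ 2))%N in
  [ffun XU : (M * M) * (M * M) =>
    let: ((x, y), (u, v)) := XU in
    (x ^+ q * u + x * u ^+ q + B * (y ^+ q * v + y * v ^+ q),
     x ^+ r * v + y * u ^+ r + a / B * (x * v ^+ r + y ^+ r * u))].

(* For #|M| = p ^ m with m even, the subfield of M of order p ^ (m / 2) is the
   set of the fixed points of x |-> x ^ (p ^ (m / 2)). *)
Definition in_half_subfield (M : finFieldType) (p m : nat) (a : M) : bool :=
  a ^+ (p ^ (m %/ 2)) == a.

(* M is meant to be a field of order p ^ (n / 2). *)
Definition family_S (M : finFieldType) (p n : nat) :
    {set multiplication (M * M)%type} :=
  let m := (n %/ 2)%N in
  [set op | [exists k : 'I_m, exists B : M, exists a : M,
    [&& (0 < k)%N, odd (m %/ gcdn k m), B != 0, ~~ is_square B,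
        a != 0, in_half_subfield p m a & op == mulS p m k B a]]].

Definition num_S (M : finFieldType) (p n : nat) : nat :=
  #|[set C in isotopy_classes p (M * M)%type |
      [exists op in family_S M p n, op \in C]]|.

(* Main.v *)
Require Import Defs.
From mathcomp Require Import all_boot all_order all_algebra all_fingroup.
From mathcomp Require Import all_solvable all_field.
From mathcomp Require Import zify ring.

Set Implicit Arguments.
Unset Strict Implicit.
Unset Printing Implicit Defensive.

Import Order.TTheory GRing.Theory Num.Theory.
Local Open Scope ring_scope.

(** Let m = n / 2. The automorphisms of M are the maps phi i : x |-> x^(p^i)
for i in Z/m; let h be the class of m / 2, so that L is the fixed field of
phi h. The condition on k says that k has odd order in Z/m.

The main point is that the components of an isotopism N (X *1 U) =
L (X) *2 T (U) between two members are monomial: L and T involve a single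
phi s and a single phi t (isotopism_monomial). Every additive map of M is a
combination of the phi i, and polynomial identities in the phi i (x) persist
when these are replaced by independent variables. The coordinates of *2 and
their conjugates become bilinear forms, each of which links two blocks of
variables: block j with block j + k, or block j with block j + k + h. When U
lives in block 0, only four coordinates of X *1 U are nonzero, hence the forms
deduced from Y *2 T (U) span a space of dimension at most 4. If T has a nonzero
component in block i, then the four forms that link i with its neighbours are
already independent (row_relation). The other ones are combinations of them,
which leaves no room for a component outside the blocks i and i + h
(far_zero), and a component in block i + h would make a nonsquare of L equal
to a square up to factors of trivial norm (conjugate_zero, norm_obstruction).

Comparing the blocks on both sides of the identity then gives k2 = k1 or
k2 = - k1, and s = t or s = t + h (block_support, support_match). The second
alternative for s meets norm_obstruction again (swapped_impossible). If k2 = k1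
and if both members have the same B, fixed by phi k1, then the matrices of L
and T are proportional to their conjugates by phi k1, and
j (a) = a^2 / (B * phi h B) satisfies j (a2) = phi t (j (a1)) or
j (a2) * phi t (j (a1)) = 1 (invariant_match). Since j (a1) lies in L, there
are at most m / 2 conjugates, hence at most m values for j (a2) and 2 m = n
values for a2.

In the other direction, B can be replaced by any nonsquare and k by m - k
(isotopic_change_B, isotopic_opposite). So the classes are all reached from
the pairs (k, a) with k an admissible exponent below m / 2 and a in L, nonzero,
for one fixed B; there are (sigma (n) - 1) / 2 * (p^(n/4) - 1) such pairs, which
is the upper bound. Taking for B a nonsquare of the subfield that is fixed by
all admissible phi k, each class is reached by at most n pairs, which is the
lower bound. All these members are presemifields (mul_eq0), so that they do
count. *)

(** * Automorphisms and additive maps of the field *)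

Lemma odd_part_odd n : (0 < n)%N -> odd (odd_part n).
Proof.
move=> n0; have [u cu nE] := pfactor_coprime (isT : prime 2) n0.
by rewrite /odd_part {1}nE mulnK ?expn_gt0 // -coprime2n.
Qed.

Section Family.

Variables (M : finFieldType) (p m : nat).
Hypotheses (p_pr : prime p) (m_gt1 : (1 < m)%N) (cardM : #|M| = (p ^ m)%N).

(** The index lives in Z/m because x^(p^m) = x on M. *)
Definition phi (i : 'Z_m) (x : M) : M := x ^+ (p ^ i).

Lemma charM : p \in [pchar M].
Proof. exact: (card_finPcharP cardM p_pr). Qed.

Lemma expr_card_modn n x : x ^+ (p ^ (n %% m)) = x ^+ (p ^ n) :> M.
Proof.
rewrite [in RHS](divn_eq n m) expnD [(n %/ m * m)%N]mulnC exprM.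
congr (_ ^+ _).
elim: (n %/ m)%N => [|d IHd]; first by rewrite muln0 expn0 expr1.
by rewrite mulnS expnD exprM -cardM expf_card.
Qed.

Lemma phiE n x : phi n%:R x = x ^+ (p ^ n).
Proof. by rewrite /phi val_Zp_nat // expr_card_modn. Qed.

Lemma phi_add i j x : phi (i + j) x = phi i (phi j x).
Proof.
have -> : i + j = ((i : nat) + (j : nat))%N%:R by rewrite natrD !natr_Zp.
by rewrite phiE /phi addnC expnD exprM.
Qed.

Lemma phi_0 x : phi 0 x = x. Proof. by rewrite /phi expn0 expr1. Qed.
Lemma phiK i : cancel (phi i) (phi (- i)).
Proof. by move=> x; rewrite -phi_add addNr phi_0. Qed.
Lemma phiNK i : cancel (phi (- i)) (phi i).
Proof. by move=> x; rewrite -phi_add addrN phi_0. Qed.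
Lemma phi_inj i : injective (phi i). Proof. exact: can_inj (phiK i). Qed.

Lemma phiD i : {morph phi i : x y / x + y}.
Proof.
move=> x y; rewrite /phi exprDn_pchar // pnatX.
by rewrite pnatE // charM.
Qed.
Lemma phiM i : {morph phi i : x y / x * y}.
Proof. by move=> x y; rewrite /phi exprMn. Qed.
Lemma phi1 i : phi i 1 = 1. Proof. by rewrite /phi expr1n. Qed.
Lemma phi0 i : phi i 0 = 0.
Proof. by rewrite /phi expr0n expn_eq0 -leqn0 leqNgt prime_gt0. Qed.
Lemma phiN i : {morph phi i : x / - x}.
Proof. by move=> x; apply/eqP; rewrite -subr_eq0 opprK -phiD addNr phi0. Qed.
Lemma phiB i : {morph phi i : x y / x - y}.
Proof. by move=> x y; rewrite phiD phiN. Qed.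
Lemma phiV i : {morph phi i : x / x^-1}.
Proof. by move=> x; rewrite /phi exprVn. Qed.
Lemma phiX i n : {morph phi i : x / x ^+ n}.
Proof. by move=> x; rewrite /phi -!exprM mulnC. Qed.
Lemma phi_div i : {morph phi i : x y / x / y}.
Proof. by move=> x y; rewrite phiM phiV. Qed.
Lemma phi_eq0 i x : (phi i x == 0) = (x == 0).
Proof. by rewrite -{1}(phi0 i) (inj_eq (@phi_inj i)). Qed.
Lemma phi_sum i (I : finType) (F : I -> M) :
  phi i (\sum_j F j) = \sum_j phi i (F j).
Proof. exact: (big_morph (phi i) (@phiD i) (phi0 i)). Qed.
Lemma phi_prod i n (F : 'I_n -> M) :
  phi i (\prod_j F j) = \prod_j phi i (F j).
Proof. exact: (big_morph (phi i) (@phiM i) (phi1 i)). Qed.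

(** A polynomial of degree less than #|M| that vanishes on M is zero. *)
Lemma phi_indep (c : 'Z_m -> M) :
  (forall x, \sum_i c i * phi i x = 0) -> forall i, c i = 0.
Proof.
move=> c0; pose P : {poly M} := \sum_i c i *: 'X^(p ^ i).
have szP : (size P <= #|M|)%N.
  apply: leq_trans (size_sum _ _ _) _; apply/bigmax_leqP => i _.
  apply: leq_trans (size_scale_leq _ _) _; rewrite size_polyXn cardM.
  by rewrite ltn_exp2l ?prime_gt1 // -[X in (_ < X)%N](Zp_cast m_gt1).
have P0 : P = 0.
  apply: (@roots_geq_poly_eq0 _ _ (enum M)); rewrite ?uniq_rootsE ?enum_uniq //.
    apply/allP=> x _; rewrite /root /P horner_sum; apply/eqP.
    by rewrite -[RHS](c0 x); apply: eq_bigr => i _; rewrite hornerZ hornerXn.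
  by rewrite -cardE.
move=> i; have := congr1 (fun q : {poly M} => q`_(p ^ i)) P0.
rewrite coef0 /P coef_sum (bigD1 i) //= coefZ coefXn eqxx mulr1 big1 ?addr0 //.
move=> j ji; rewrite coefZ coefXn eqn_exp2l ?prime_gt1 // eq_sym.
by rewrite val_eqE (negbTE ji) mulr0.
Qed.

(** The matrix of this linear system has full rank by phi_indep. The weights w
let the values phi i x be treated as independent variables. *)
Lemma phi_dual (xi : 'Z_m -> M) :
  exists w : M -> M, forall i, \sum_x w x * phi i x = xi i.
Proof.
pose A := \matrix_(x < #|M|, i < (Zp_trunc m).+2) phi i (enum_val x).
have fA : row_free A^T.
  apply/inj_row_free => v vA; apply/rowP => i; rewrite mxE.
  apply: (phi_indep (c := v 0)) => x.
  have /rowP/(_ (enum_rank x)) := vA.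
  rewrite mxE [RHS]mxE => vAx; rewrite -[RHS]vAx; apply: eq_bigr => j _.
  by rewrite !mxE enum_rankK.
have fullA : row_full A by move: fA; rewrite /row_free mxrank_tr.
have /submxP[w wE] : (\row_i xi i <= A)%MS by apply: submx_full.
exists (fun x => w 0 (enum_rank x)) => i.
have /rowP/(_ i) := wE; rewrite !mxE => ->.
rewrite [RHS](reindex enum_rank) /=; last exact/onW_bij/enum_rank_bij.
by apply: eq_bigr => x _; rewrite mxE enum_rankK.
Qed.

(** The polynomial X^p - X already has the p roots n%:R. *)
Lemma phi1_fixed x : phi 1 x = x -> exists n, x = n%:R.
Proof.
rewrite -[1]/(1%:R) phiE expn1 => xp.
pose f (y : 'I_p) : M := (y : nat)%:R.
have fp n : n%:R ^+ p = n%:R :> M.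
  by rewrite -(pFrobenius_autE charM) rmorph_nat.
have injf : injective f.
  move=> y z /eqP; wlog: y z / (y <= z)%N => [W|yz].
    by case: (leqP y z) => [/W//|/ltnW/W] H /eqP E; apply/esym/H; rewrite E.
  rewrite eq_sym -subr_eq0 -natrB // -(dvdn_pcharf charM) => /dvdnP[d dE].
  apply: val_inj => /=; have := ltn_ord z; case: d dE => [|d] dE; first by lia.
  by rewrite mulSn in dE; lia.
have [/mapP[y _ ->]|nx] := boolP (x \in [seq f y | y : 'I_p]); first by exists y.
pose P : {poly M} := 'X^p - 'X.
have szP : size P = p.+1.
  by rewrite size_polyDl size_polyXn // size_polyN size_polyX ltnS prime_gt1.
have P0 : P != 0 by rewrite -size_poly_eq0 szP.
have := max_poly_roots P0 (rs := x :: [seq f y | y : 'I_p]).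
rewrite szP /= size_map -cardE card_ord ltnn nx map_inj_uniq ?enum_uniq //.
move=> H; suff: false by []; apply: H => //; apply/andP; split.
  by rewrite rootE !hornerE xp subrr.
by apply/allP => _ /mapP[y _ ->]; rewrite rootE !hornerE fp subrr.
Qed.

(** With w dual to the phi i, every t is the sum of the x * Tr (w x * t). The
trace lies in the prime field, so that it commutes with the additive map g. *)
Lemma additive_phi (g : M -> M) : (forall x y, g (x + y) = g x + g y) ->
  exists c : 'Z_m -> M, forall x, g x = \sum_i c i * phi i x.
Proof.
move=> gD.
have g0 : g 0 = 0 by apply: (addrI (g 0)); rewrite -gD !addr0.
have gM x n : g (x * n%:R) = g x * n%:R.
  elim: n => [|n IHn]; first by rewrite !mulr0 g0.
  by rewrite -natr1 !mulrDr gD IHn !mulr1.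
have gS (F : M -> M) : g (\sum_x F x) = \sum_x g (F x).
  exact: (big_morph g gD g0).
have [w wE] := phi_dual (fun i => (i == 0)%:R).
have w' i : \sum_x x * phi i (w x) = (i == 0)%:R.
  apply: (@phi_inj (- i)); rewrite phi_sum.
  under eq_bigr => x _ do rewrite phiM phiK mulrC.
  by rewrite wE oppr_eq0; case: eqP; rewrite ?phi1 ?phi0.
pose tr y := \sum_i phi i y.
have trZ y : exists n, tr y = n%:R.
  apply: phi1_fixed; rewrite phi_sum (reindex_inj (addrI (-1))) /=.
  by apply: eq_bigr => i _; rewrite -phi_add addrA addrN add0r.
exists (fun i => \sum_x g x * phi i (w x)) => t.
have tE : t = \sum_x x * tr (w x * t).
  under eq_bigr => x _ do rewrite mulr_sumr.
  rewrite exchange_big /=.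
  have E i : \sum_x x * phi i (w x * t) = (i == 0)%:R * phi i t.
    under eq_bigr => x _ do rewrite phiM mulrA.
    by rewrite -mulr_suml w'.
  under eq_bigr => i _ do rewrite E.
  rewrite (bigD1 0) //= big1 ?addr0 ?eqxx ?mul1r ?phi_0 // => i /negPf ->.
  by rewrite mul0r.
rewrite {1}tE gS; under [RHS]eq_bigr => i _ do rewrite mulr_suml.
rewrite exchange_big /=; apply: eq_bigr => x _.
have [n trE] := trZ (w x * t); rewrite trE gM -trE mulr_sumr.
by apply: eq_bigr => i _; rewrite phiM mulrA.
Qed.

(** * The quadratic character and the subfield L *)

Hypotheses (p_odd : odd p) (m_even : ~~ odd m).

Local Notation Q := (p ^ (m %/ 2))%N.
Local Notation h := ((m %/ 2)%:R : 'Z_m).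

Lemma odd_Q : odd Q. Proof. by rewrite oddX p_odd orbT. Qed.

Lemma Q_gt1 : (1 < Q)%N.
Proof. by rewrite -(expn0 p) ltn_exp2l ?prime_gt1 // divn_gt0. Qed.

Lemma Q_odd_gt1 : exists d, Q = (2 * d + 3)%N.
Proof.
exists ((Q - 3) %/ 2)%N; move: odd_Q Q_gt1; generalize Q => q.
by case: q => [|[|[|q]]] //; lia.
Qed.

Lemma cardM_sqr : #|M| = (Q * Q)%N.
Proof. by rewrite cardM -expnD; congr (_ ^ _)%N; lia. Qed.

Lemma hh0 : h + h = 0.
Proof.
rewrite -natrD (_ : _ + _ = m)%N; last by lia.
by rewrite pchar_Zp.
Qed.

Lemma h_neq0 : h != 0.
Proof.
apply/eqP => /(congr1 (@nat_of_ord _)); rewrite val_Zp_nat //= modn_small; lia.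
Qed.

Lemma oppr_h : - h = h.
Proof. by apply/eqP; rewrite -subr_eq0 -opprD hh0 oppr0. Qed.

Lemma phi_hK : involutive (phi h).
Proof. by move=> x; rewrite -phi_add hh0 phi_0. Qed.

Lemma expr_card1 (x : M) : x != 0 -> x ^+ #|M|.-1 = 1.
Proof.
move=> x0; apply: (mulfI x0); rewrite -exprS prednK.
  by rewrite expf_card mulr1.
by rewrite cardM_sqr; have [d ->] := Q_odd_gt1; nia.
Qed.

Lemma ex_primitive_root : exists g : M, #|M|.-1.-primitive_root g.
Proof.
have M0 : (0 < #|M|.-1)%N.
  by have := Q_gt1; rewrite cardM_sqr; case: Q => [|[|n]] //; rewrite mulSn.
have /hasP[g _ gP] : has (#|M|.-1).-primitive_root [seq x <- enum M | x != 0].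
  apply: has_prim_root => //.
  - apply/allP => x; rewrite mem_filter => /andP[x0 _].
    by rewrite unity_rootE expr_card1.
  - by rewrite filter_uniq ?enum_uniq.
  - rewrite -(cardsC1 (0 : M)) cardE; apply: eq_leq; congr size.
    by rewrite enumT; apply: eq_filter => x; rewrite !inE.
by exists g.
Qed.

(** The exponent is (#|M| - 1) / 2; the factor Q - 1 shows that chi is trivial
on L. *)
Definition chi (x : M) : M := x ^+ ((Q - 1) * ((Q + 1) %/ 2)).

Lemma chi_exp : ((Q - 1) * ((Q + 1) %/ 2) * 2 = #|M|.-1)%N.
Proof. by rewrite cardM_sqr; have [d ->] := Q_odd_gt1; nia. Qed.

Lemma chi0 : chi 0 = 0.
Proof.
rewrite /chi expr0n; have -> : ((Q - 1) * ((Q + 1) %/ 2) == 0)%N = false.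
  by have [d ->] := Q_odd_gt1; nia.
by [].
Qed.

Lemma chiN1_neq0 x : chi x = -1 -> x != 0.
Proof.
by apply: contra_eq_neq => ->; rewrite chi0 eq_sym oppr_eq0 oner_neq0.
Qed.

Lemma chiM x y : chi (x * y) = chi x * chi y.
Proof. exact: exprMn. Qed.

Lemma chi_sqr x : x != 0 -> chi x ^+ 2 = 1.
Proof. by move=> x0; rewrite -exprM chi_exp expr_card1. Qed.

Lemma chi_expn2 x : x != 0 -> chi (x ^+ 2) = 1.
Proof. by move=> x0; rewrite /chi exprAC chi_sqr. Qed.

Lemma chi_phi i x : chi (phi i x) = chi x.
Proof.
have [->|x0] := eqVneq x 0; first by rewrite phi0.
rewrite /chi -phiX -/(chi x).
have := chi_sqr x0; move/eqP; rewrite sqrf_eq1 => /orP[]/eqP ->.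
  by rewrite phi1.
by rewrite phiN phi1.
Qed.

Lemma m1_neq1 : (-1 : M) != 1.
Proof.
rewrite eq_sym -subr_eq0 opprK -mulr2n -(dvdn_pcharf charM).
apply/negP => /dvdn_leq; have := prime_gt1 p_pr; have := p_odd.
by case: p => [|[|[|]]] // n _ _ /(_ isT).
Qed.

Lemma chi1_is_square x : chi x = 1 -> is_square x.
Proof.
move=> chix; have x0 : x != 0.
  by apply: contra_eqN chix => /eqP ->; rewrite chi0 eq_sym oner_neq0.
have [g gP] := ex_primitive_root.
have [[i lti] /= xE] := prim_rootP gP (expr_card1 x0).
move: chix; rewrite xE /chi -exprM => /eqP; rewrite -(prim_order_dvd gP).
rewrite -chi_exp mulnC dvdn_pmul2r; last first.
  by have [d ->] := Q_odd_gt1; nia.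
move=> /dvdnP[j ->]; apply/existsP; exists (g ^+ j).
by rewrite -exprM.
Qed.

Lemma chi_nonsquare (x : M) : x != 0 -> ~~ is_square x -> chi x = -1.
Proof.
move=> /chi_sqr/eqP; rewrite sqrf_eq1 => /orP[]/eqP // /chi1_is_square.
by move=> ->.
Qed.

Lemma half_expr x : x != 0 -> phi h x = x -> x ^+ (Q - 1) = 1.
Proof.
move=> x0; rewrite phiE => xQ; apply: (mulfI x0).
by rewrite -exprS mulr1 subn1 prednK // expn_gt0 prime_gt0.
Qed.

Lemma chi_half x : x != 0 -> phi h x = x -> chi x = 1.
Proof. by move=> x0 xh; rewrite /chi exprM half_expr // expr1n. Qed.

Lemma chiN1 : chi (-1) = 1.
Proof. by rewrite chi_half ?oppr_eq0 ?oner_eq0 // phiN phi1. Qed.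

Lemma chiN x : chi (- x) = chi x.
Proof. by rewrite -[- x]mulN1r chiM chiN1 mul1r. Qed.

(** If c were in L, raising the equation to the power (Q - 1) / 2 would give
chi b = 1. *)
Lemma nonsquare_norm b c : chi b = -1 -> phi h c = c ->
  c ^+ 2 = b * phi h b -> False.
Proof.
move=> chib ch cE; have b0 := chiN1_neq0 chib.
have c0 : c != 0.
  have : c ^+ 2 != 0 by rewrite cE mulf_neq0 ?phi_eq0.
  by rewrite expf_eq0.
have := half_expr c0 ch.
have {1}-> : (Q - 1 = 2 * ((Q - 1) %/ 2))%N by have [d ->] := Q_odd_gt1; lia.
rewrite exprM cE phiE -exprS -exprM => b1.
have E : ((Q - 1) * ((Q + 1) %/ 2) = Q.+1 * ((Q - 1) %/ 2))%N.
  have [d ->] := Q_odd_gt1.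
  rewrite (_ : (2 * d + 3 - 1 = d.+1 * 2)%N); last by lia.
  by rewrite (_ : (2 * d + 3 + 1 = d.+2 * 2)%N) ?mulnK //; nia.
by have := m1_neq1; rewrite -chib /chi E b1 eqxx.
Qed.

Lemma ex_nonsquare : exists g : M, chi g = -1.
Proof.
have [g gP] := ex_primitive_root; exists g.
have g0 : g != 0.
  apply: contraTneq gP => ->; apply/negP => /prim_expr_order/eqP.
  rewrite expr0n -chi_exp; have -> : ((Q - 1) * ((Q + 1) %/ 2) * 2 == 0)%N = false.
    by have [d ->] := Q_odd_gt1; nia.
  by rewrite eq_sym oner_eq0.
have /eqP := chi_sqr g0; rewrite sqrf_eq1 => /orP[]/eqP // /eqP.
rewrite /chi -(prim_order_dvd gP) -chi_exp => /dvdn_leq.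
by have [d ->] := Q_odd_gt1; nia.
Qed.

Lemma card_half : #|[set a : M | (a != 0) && (phi h a == a)]| = (Q - 1)%N.
Proof.
have [g gP] := ex_primitive_root.
have g0 : g != 0.
  apply: contraTneq gP => ->; apply/negP => /prim_expr_order/eqP.
  rewrite expr0n -chi_exp; have -> : ((Q - 1) * ((Q + 1) %/ 2) * 2 == 0)%N = false.
    by have [d ->] := Q_odd_gt1; nia.
  by rewrite eq_sym oner_eq0.
pose f (i : 'I_(Q - 1)) := g ^+ (Q.+1 * i).
have fi : injective f.
  move=> i j /eqP; rewrite (eq_prim_root_expr gP) => /eqP.
  have lt_ (i' : 'I_(Q - 1)) : (Q.+1 * i' < #|M|.-1)%N.
    case: i' => i' lti /=; rewrite cardM_sqr; move: lti.
    by have [d ->] := Q_odd_gt1; nia.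
  rewrite !modn_small // => /eqP; rewrite eqn_pmul2l // => /eqP.
  exact: val_inj.
rewrite -[RHS]card_ord -(card_imset _ fi); apply: eq_card => a; rewrite inE.
apply/andP/imsetP => [[a0 /eqP ah] | [i _ ->]].
  have [[j ltj] /= aE] := prim_rootP gP (expr_card1 a0).
  have := half_expr a0 ah; rewrite aE -exprM => /eqP.
  rewrite -(prim_order_dvd gP) (_ : #|M|.-1 = Q.+1 * (Q - 1))%N; last first.
    by rewrite cardM_sqr; have [d ->] := Q_odd_gt1; nia.
  rewrite dvdn_pmul2r; last by have [d ->] := Q_odd_gt1; lia.
  case/dvdnP => d jE; have dlt : (d < Q - 1)%N.
    move: ltj; rewrite jE cardM_sqr; have [d' ->] := Q_odd_gt1; nia.
  by exists (Ordinal dlt); rewrite // /f /= mulnC -jE.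
rewrite expf_neq0 //; split=> //; rewrite phiE.
have xQ1 : (g ^+ (Q.+1 * i)) ^+ (Q - 1) = 1.
  rewrite -exprM (_ : (Q.+1 * i * (Q - 1) = #|M|.-1 * i)%N); last first.
    case: i => i lti /=; rewrite cardM_sqr; clear lti.
    by  have [d ->] := Q_odd_gt1; nia.
  by rewrite exprM (prim_expr_order gP) expr1n.
have QE : Q = (Q - 1).+1 by have [d ->] := Q_odd_gt1; lia.
by rewrite [X in _ ^+ X == _]QE exprS xQ1 mulr1.
Qed.

(** * Exponents of odd order and norms *)

Local Notation l := (odd_part m).
(** For a nonzero k below m this is the condition that m / gcd (k, m) is odd;
see odd_quotient and odd_order_nat. *)
Definition odd_order (k : 'Z_m) := k *+ l == 0.

Let odd_l : odd l. Proof. exact: odd_part_odd (ltnW m_gt1). Qed.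

Lemma odd_orderD i j : odd_order i -> odd_order j -> odd_order (i + j).
Proof. by rewrite /odd_order mulrnDl => /eqP -> /eqP ->; rewrite addr0. Qed.

Lemma odd_orderN i : odd_order i -> odd_order (- i).
Proof. by rewrite /odd_order mulNrn oppr_eq0. Qed.

Lemma odd_order_h : ~~ odd_order h.
Proof.
rewrite /odd_order -(odd_double_half l) odd_l mulrnDr mulr1n.
by rewrite -muln2 mulnC mulrnA mulr2n hh0 mul0rn addr0 h_neq0.
Qed.

Lemma odd_order_dbl i : odd_order i -> i + i = 0 -> i = 0.
Proof.
rewrite /odd_order -(odd_double_half l) odd_l mulrnDr mulr1n => /eqP E ii.
by move: E; rewrite -muln2 mulnC mulrnA mulr2n ii mul0rn addr0.
Qed.

Let half_l : (2 * l.+1./2 = l.+1)%N. Proof. by have := odd_l; lia. Qed.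

(** A power, of odd exponent, of the norm to the fixed field of phi k when k
has odd order. *)
Definition norm_k (k : 'Z_m) (x : M) := \prod_(i < l) phi (k *+ i) x.

Lemma norm_kM k : {morph norm_k k : x y / x * y}.
Proof.
by move=> x y; rewrite -big_split; apply: eq_bigr => i _; rewrite phiM.
Qed.

Lemma norm_k_phi i k x : norm_k k (phi i x) = phi i (norm_k k x).
Proof.
by rewrite phi_prod; apply: eq_bigr => j _; rewrite -!phi_add addrC.
Qed.

Lemma norm_k_fixed k x : odd_order k -> phi k (norm_k k x) = norm_k k x.
Proof.
move=> /eqP kl; rewrite phi_prod /norm_k.
under eq_bigr => i _ do rewrite -phi_add -mulrS.
have l0 : (0 < l)%N by rewrite odd_gt0 ?odd_l.
rewrite -[in LHS](prednK l0) -[in RHS](prednK l0).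
by rewrite big_ord_recr [RHS]big_ord_recl /= prednK // kl mulr0n mulrC.
Qed.

Lemma norm_k_eq0 k x : (norm_k k x == 0) = (x == 0).
Proof.
apply/prodf_eq0/eqP => [[i _]|->]; first by rewrite phi_eq0 => /eqP.
by exists (Ordinal (odd_gt0 odd_l)); rewrite ?phi0.
Qed.

Lemma chi_prod n (F : 'I_n -> M) : chi (\prod_i F i) = \prod_i chi (F i).
Proof. by rewrite /chi prodrXl. Qed.

Lemma chi_norm_k k x : chi x = -1 -> chi (norm_k k x) = -1.
Proof.
move=> xN; rewrite chi_prod; under eq_bigr => i _ do rewrite chi_phi xN.
by rewrite prodr_const card_ord -signr_odd odd_l.
Qed.

(** The norm along k removes w and leaves the norm from M to L of a nonsquare
equal to the square of an element of L. *)
Lemma norm_obstruction k b e w : odd_order k -> chi b = -1 -> phi h e = e ->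
  w != 0 -> phi (k + k) w * (b * phi h b) = e * phi k e * w -> False.
Proof.
move=> kO chib eh w0 /(congr1 (norm_k k)).
rewrite !norm_kM !norm_k_phi phi_add !norm_k_fixed // [RHS]mulrC.
move=> /(mulfI _) E; apply: (nonsquare_norm (c := norm_k k e) (chi_norm_k k chib)).
  by rewrite -norm_k_phi eh.
by rewrite expr2 E ?norm_k_eq0.
Qed.

(** The norm of -1 along k is a product of an odd number of factors -1. *)
Lemma no_neg_fixed k x : odd_order k -> x != 0 -> phi k x != - x.
Proof.
move=> kO x0; apply/eqP => /(congr1 (norm_k k)).
rewrite norm_k_phi norm_k_fixed // -mulN1r norm_kM.
have -> : norm_k k (-1) = -1.
  rewrite /norm_k; under eq_bigr => i _ do rewrite phiN phi1.
  by rewrite prodr_const card_ord -signr_odd odd_l.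
move/eqP; rewrite -subr_eq0 -{1}[norm_k k x]mul1r -mulrBl mulf_eq0.
by rewrite subr_eq0 eq_sym (negPf m1_neq1) norm_k_eq0 (negPf x0).
Qed.

Lemma phi_dbl_fixed k x : odd_order k -> phi (k + k) x = x -> phi k x = x.
Proof.
move=> kO xkk; apply/eqP; rewrite -subr_eq0; apply/negPn/negP => d0.
by have := no_neg_fixed kO d0; rewrite phiB -phi_add xkk opprB eqxx.
Qed.

(** * Offsets between linked blocks *)

(** For each t the values v r t are coordinates of a vector in the span of
#|I| columns. The coordinates rs form a coordinate system of that span, as
their matrix on the vectors ts is diagonal and invertible. *)
Lemma rank_relation (I : finType) (R T : Type) (v : R -> T -> M)
    (C : R -> I -> M) (rs : I -> R) (ts : I -> T) :
  (forall t, exists f : I -> M, forall r, v r t = \sum_b C r b * f b) ->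
  (forall a b, (v (rs a) (ts b) == 0) = (a != b)) ->
  forall r, exists c : I -> M, forall t, v r t = \sum_a c a * v (rs a) t.
Proof.
move=> vC vD r.
have [F FE] := fin_all_exists (fun a => vC (ts a)).
pose ev (i : 'I_#|I|) : I := enum_val i.
pose A := \matrix_(i, j) C (rs (ev i)) (ev j).
pose B := \matrix_(i, j) F (ev j) (ev i).
have sumE (G : I -> M) : \sum_b G b = \sum_(j < #|I|) G (ev j).
  rewrite [RHS](reindex enum_rank) /=; last exact/onW_bij/enum_rank_bij.
  by apply: eq_bigr => x _; rewrite /ev enum_rankK.
have AB : A *m B = diag_mx (\row_i v (rs (ev i)) (ts (ev i))).
  apply/matrixP => i j; rewrite !mxE; case: eqVneq => [->|ij].
    rewrite mulr1n FE sumE; apply: eq_bigr => b _; by rewrite !mxE.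
  rewrite mulr0n; have /eqP : v (rs (ev i)) (ts (ev j)) == 0.
    by rewrite vD (inj_eq (@enum_val_inj _ _)).
  by rewrite FE sumE => E; rewrite -[RHS]E; apply: eq_bigr => b _; rewrite !mxE.
have uA : A \in unitmx.
  have : A *m B \in unitmx.
    rewrite AB unitmxE det_diag unitfE; apply/prodf_neq0 => i _.
    by rewrite mxE vD eqxx.
  by rewrite unitmx_mul => /andP[].
pose c := (\row_j C r (ev j)) *m invmx A.
exists (fun a => c 0 (enum_rank a)) => t; have [f fE] := vC t.
have CE j : C r (ev j) = \sum_i c 0 i * C (rs (ev i)) (ev j).
  have /rowP/(_ j) : c *m A = \row_j C r (ev j) by rewrite mulmxKV.
  by rewrite !mxE => <-; apply: eq_bigr => i _; rewrite !mxE.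
rewrite fE !sumE; under eq_bigr => j _ do rewrite CE mulr_suml.
rewrite exchange_big /=; apply: eq_bigr => i _.
rewrite /ev enum_valK -/(ev i) fE sumE mulr_sumr; apply: eq_bigr => j _.
by rewrite mulrA.
Qed.

Lemma dbl_eq0 (d : 'Z_m) : d + d = 0 -> d = 0 \/ d = h.
Proof.
move=> dd; pose n : nat := d; have dE : d = n%:R by rewrite natr_Zp.
have ltn : (n < m)%N by rewrite -[X in (_ < X)%N](Zp_cast m_gt1) ltn_ord.
move: dd; rewrite dE -natrD => /(congr1 (@nat_of_ord _)).
rewrite val_Zp_nat //= => E.
have [n0|n0] := eqVneq n 0; first by left; rewrite n0.
right; congr (_%:R); have /dvdnP[c] : (m %| n + n)%N by rewrite /dvdn E.
by case: c => [|[|c]]; nia.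
Qed.

(** The first boolean tells which coordinate of the product links j with j + k
(true) or j + k + h (false); the second one gives the direction of the link.
*)
Definition offset (k : 'Z_m) (t : bool * bool) : 'Z_m :=
  let d := if t.1 then k else k + h in if t.2 then d else - d.

Section Offsets.

Variable k : 'Z_m.
Hypotheses (kO : odd_order k) (k0 : k != 0).

Lemma dbl_neq0 : k + k != 0.
Proof. by apply: contra_neq k0 => /(odd_order_dbl kO). Qed.

Lemma dbl2_neq0 : k + k + (k + k) != 0.
Proof.
by apply: contra_neq dbl_neq0; apply: odd_order_dbl; apply: odd_orderD.
Qed.

(** Doubling kills h, so that it only remembers k up to sign. *)
Lemma offset_dbl t : offset k t + offset k t = k + k \/
  offset k t + offset k t = - (k + k).
Proof.
have E : k + h + (k + h) = k + k by rewrite addrACA hh0 addr0.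
by case: t => [[] []]; rewrite /offset /= -?opprD ?E; by [left | right].
Qed.

Lemma offset_neq0 t : offset k t != 0.
Proof.
apply: contraNneq dbl_neq0 => t0.
by case: (offset_dbl t); rewrite t0 addr0 => /esym/eqP; rewrite ?oppr_eq0.
Qed.

Lemma offset_inj : injective (offset k).
Proof.
have kh : k != k + h by rewrite -subr_eq0 opprD addNKr oppr_eq0 h_neq0.
have kNk : k != - k by rewrite -subr_eq0 opprK dbl_neq0.
have kNkh : k != - (k + h).
  rewrite -subr_eq0 opprK addrA; apply: contraNneq odd_order_h => E.
  have -> : h = - (k + k) by apply/eqP; rewrite -subr_eq0 opprK addrC E.
  by rewrite odd_orderN // odd_orderD.
have khNk : k + h != - k.
  by rewrite -(inj_eq oppr_inj) opprK eq_sym.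
have khNkh : k + h != - (k + h).
  by rewrite -subr_eq0 opprK addrACA hh0 addr0 dbl_neq0.
have E1 : - k != - (k + h) by rewrite (inj_eq oppr_inj).
move=> [[] []] [[] []]; rewrite /offset /= => /eqP //;
  rewrite ?(negPf kh) ?(negPf kNk) ?(negPf kNkh) ?(negPf khNk) ?(negPf khNkh)
    ?(negPf E1) // eq_sym
    ?(negPf kh) ?(negPf kNk) ?(negPf kNkh) ?(negPf khNk) ?(negPf khNkh)
    ?(negPf E1) //.
Qed.

Lemma offset_h t : exists t', offset k t + offset k t' = h.
Proof.
case: t => [[] []]; rewrite /offset /=.
- by exists (false, false); rewrite /= opprD oppr_h addNKr.
- by exists (false, true); rewrite /= addKr.
- by exists (true, false); rewrite /= addrAC subrr add0r.
- by exists (true, true); rewrite /= opprD oppr_h addrAC addNr add0r.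
Qed.

(** Join two exponents when they differ by an offset. Only 0 and h have all
their neighbours among 0 and the neighbours of 0: a neighbour d of 0 has the
neighbour h, and for any other d the doubles of the relations d + offset =
offset give d + d = 0 or 8 k = 0. *)
Lemma nonoffset_neighbour d : d != 0 -> d != h ->
  exists2 t, d + offset k t != 0 & forall t', d + offset k t != offset k t'.
Proof.
move=> d0 dh.
(* If d is an offset, take its neighbour h, which is no offset as h + h = 0.
*)
have [/existsP[t /eqP dt]|] := boolP [exists t, d == offset k t].
  have [t' tt'] := offset_h t; exists t'; rewrite dt tt' ?h_neq0 // => t2.
  apply: contraNneq dbl_neq0 => /(congr1 (fun x => x + x)); rewrite hh0.
  by case: (offset_dbl t2) => -> /esym/eqP; rewrite ?oppr_eq0.
rewrite negb_exists => /forallP dN.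
have dt0 t : d + offset k t != 0.
  have [t' tt'] : exists t', offset k t' = - offset k t.
    by exists (t.1, ~~ t.2); case: t => [[] []]; rewrite /offset /= ?opprK.
  by rewrite -(opprK (offset k t)) -tt' subr_eq0 dN.
have [/existsP[t tP]|] :=
    boolP [exists t, forall t', d + offset k t != offset k t'].
  by exists t => //; apply/forallP.
rewrite negb_exists => /forallP noff; exfalso.
have dbl t : d + d + (offset k t + offset k t) = k + k \/
             d + d + (offset k t + offset k t) = - (k + k).
  have := noff t; rewrite negb_forall => /existsP[t']; rewrite negbK => /eqP E.
  by rewrite addrACA E; apply: offset_dbl.
have D0 : d + d != 0.
  by apply/eqP => /dbl_eq0[/eqP|/eqP]; rewrite ?(negPf d0) ?(negPf dh).
have KO : odd_order (k + k) by exact: odd_orderD.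
have K4 := contra_neq (odd_order_dbl (odd_orderD KO KO)) dbl2_neq0.
have := dbl (true, true); have := dbl (true, false); rewrite /offset /=.
rewrite -opprD; move: (d + d) D0 (k + k) K4 => D D0 K K4.
have abs1 : D + K <> K by move/eqP; rewrite -subr_eq0 addrK (negPf D0).
have abs2 : D - K <> - K by move/eqP; rewrite -subr_eq0 opprK subrK (negPf D0).
case=> [E1|//] [//|E2]; case/eqP: K4.
have -> : K + K = D by rewrite -{1}E1 subrK.
by rewrite -{2}(subrK K D) E1 addrA E2 addNr.
Qed.

(** * Spaces of bilinear forms of dimension four *)

Definition single (j : 'Z_m) (s : M) (i : 'Z_m) : M := if i == j then s else 0.

Lemma single_eq j s : single j s j = s. Proof. by rewrite /single eqxx. Qed.
Lemma single_neq i j s : i != j -> single j s i = 0.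
Proof. by rewrite /single => /negPf ->. Qed.

Section Rows.

Variables (B a : M) (E : Type) (alpha beta : 'Z_m -> E -> M).

(** The image by phi r.2 of the coordinate r.1 of the product, where the
conjugates of the two arguments have been replaced by independent variables;
see phi_mul. *)
Definition row_form (r : bool * 'Z_m) (t : ('Z_m -> M) * ('Z_m -> M) * E) : M :=
  let: (x, y, e) := t in let j := r.2 in
  if r.1 then
    x (j + k) * alpha j e + x j * alpha (j + k) e
      + phi j B * (y (j + k) * beta j e + y j * beta (j + k) e)
  else
    x (j + (k + h)) * beta j e + y j * alpha (j + (k + h)) e
      + phi j (a / B) * (x j * beta (j + (k + h)) e + y (j + (k + h)) * alpha j e).

(** The form that links block i with block i + offset k t. *)
Definition edge (i : 'Z_m) (t : bool * bool) : bool * 'Z_m :=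
  (t.1, if t.2 then i else i + offset k t).

(** The value of the form edge i t on a first argument (s, u) in block i +
offset k t; see row_edge. *)
Definition edge_pair (i : 'Z_m) (t : bool * bool) (s u : M) (e : E) : M :=
  let j := i + offset k t in
  match t with
  | (true, true) => s * alpha i e + phi i B * (u * beta i e)
  | (true, false) => s * alpha i e + phi j B * (u * beta i e)
  | (false, true) => s * beta i e + phi i (a / B) * (u * alpha i e)
  | (false, false) => u * alpha i e + phi j (a / B) * (s * beta i e)
  end.

Lemma row_edge i t s u e :
  row_form (edge i t)
    (single (i + offset k t) s, single (i + offset k t) u, e) =
  edge_pair i t s u e.
Proof.
have i0 t' : i == i + offset k t' = false.
  by rewrite eq_sym -subr_eq0 addrAC subrr add0r (negPf (offset_neq0 _)).
have := i0 t; case: t => [[] []] /=; rewrite /row_form /edge_pair /edge /=.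
all: rewrite /offset /= ?subrK => i0t.
all: rewrite !(single_eq, single_neq) ?i0t ?negbT //.
all: by rewrite ?(mul0r, mulr0, addr0, add0r).
Qed.

Lemma row_edge_other i t l s u e : l != i -> l != i + offset k t ->
  row_form (edge i t) (single l s, single l u, e) = 0.
Proof.
rewrite eq_sym => li; rewrite eq_sym.
case: t => [[] []] /=; rewrite /row_form /edge /= /offset /= ?subrK => lo.
all: rewrite !single_neq //.
all: by rewrite ?(mul0r, mulr0, addr0, add0r).
Qed.

Hypotheses (B0 : B != 0) (a0 : a != 0).

Lemma edge_pair_neq0 i t e : (alpha i e != 0) || (beta i e != 0) ->
  exists su, edge_pair i t su.1 su.2 e != 0.
Proof.
have A0 j : phi j (a / B) != 0 by rewrite phi_eq0 mulf_neq0 ?invr_eq0.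
have B0' j : phi j B != 0 by rewrite phi_eq0.
have [al0|al0 /= be0] := boolP (alpha i e == 0); last first.
  exists (if t.1 then (1, 0) else (0, 1));
  by case: t => [[] []] /=; rewrite !mul1r mul0r ?mulr0 ?add0r ?addr0 ?mulf_neq0.
move=> be0; exists (if t.1 then (0, 1) else (1, 0));
case: t => [[] []] /=; rewrite ?(eqP al0) ?mul0r ?mul1r ?mulr0 ?add0r ?addr0.
all: by rewrite ?mulf_neq0.
Qed.

Hypotheses (chiB : chi B = -1) (ah : phi h a = a).
Variables (C : bool * 'Z_m -> bool * bool -> M).
Hypothesis rank4 : forall t, exists f : bool * bool -> M,
  forall r, row_form r t = \sum_b C r b * f b.
Variables (i : 'Z_m) (e0 : E).
Hypothesis nz : (alpha i e0 != 0) || (beta i e0 != 0).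

(** The four edges at i are independent since each of them involves its own
neighbour of i. *)
Lemma row_relation r : exists c : bool * bool -> M, forall t,
  row_form r t = \sum_b c b * row_form (edge i b) t.
Proof.
have [su suP] := fin_all_exists (fun t => edge_pair_neq0 t nz).
pose ts b := (single (i + offset k b) (su b).1, single (i + offset k b) (su b).2, e0).
apply: (rank_relation (ts := ts)) rank4 _ r => b b'.
have [<-|bb'] := eqVneq b b'; first by rewrite row_edge (negPf (suP b)).
rewrite row_edge_other ?eqxx //.
  by rewrite -subr_eq0 addrAC subrr add0r offset_neq0.
by rewrite (inj_eq (addrI i)) (inj_eq offset_inj) eq_sym.
Qed.

(** Such an l has a neighbour where no edge at i is supported, hence where all
forms vanish, and that includes the edge from l. *)
Lemma far_zero l : l != i -> l != i + h -> forall e, alpha l e = 0 /\ beta l e = 0.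
Proof.
move=> li lih e.
have [||t] := @nonoffset_neighbour (l - i); first by rewrite subr_eq0.
  by rewrite subr_eq addrC.
rewrite addrAC => t0 tN.
have [/orP nzl|] := boolP ((alpha l e != 0) || (beta l e != 0)); last first.
  by rewrite negb_or !negbK => /andP[/eqP -> /eqP ->].
have [[s u] /=] := edge_pair_neq0 t (introT orP nzl).
rewrite -row_edge; have [c ->] := row_relation (edge l t).
rewrite big1 ?eqxx // => b _; rewrite row_edge_other ?mulr0 //.
  by rewrite -subr_eq0.
by apply: contra_neq (tN b) => ->; rewrite addrAC subrr add0r.
Qed.

Lemma row_at_edge r b : exists c, forall s u e,
  row_form r (single (i + offset k b) s, single (i + offset k b) u, e) =
    c * edge_pair i b s u e.
Proof.
have [c cE] := row_relation r; exists (c b) => s u e.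
rewrite cE (bigD1 b) // row_edge big1 => [|b' bb']; first by rewrite /= addr0.
rewrite row_edge_other ?mulr0 //.
  by rewrite -subr_eq0 addrAC subrr add0r offset_neq0.
by rewrite (inj_eq (addrI i)) (inj_eq offset_inj) eq_sym.
Qed.

(** The blocks i and i + h have the same neighbours. On block i + k, then on
block i - k, the edge from i + h must be a multiple of the edge from i. *)
Lemma conjugate_relations : exists c d : M, forall e,
  [/\ beta (i + h) e = c * alpha i e,
      phi (i + h) (a / B) * alpha (i + h) e = c * (phi i B * beta i e),
      phi (i - k) (a / B) * beta (i + h) e = d * alpha i e
    & alpha (i + h) e = d * (phi (i - k) B * beta i e)].
Proof.
have E1 : i + offset k (true, true) = i + h + offset k (false, true).
  by rewrite /offset /= addrACA hh0 addr0.
have E2 : i + offset k (true, false) = i + h + offset k (false, false).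
  by rewrite /offset /= opprD oppr_h addrACA hh0 addr0.
have [c cE] := row_at_edge (edge (i + h) (false, true)) (true, true).
have [d dE] := row_at_edge (edge (i + h) (false, false)) (true, false).
rewrite E1 in cE; rewrite E2 in dE.
have {}cE s u e := etrans (esym (row_edge _ _ _ _ _)) (cE s u e).
have {}dE s u e := etrans (esym (row_edge _ _ _ _ _)) (dE s u e).
rewrite /edge_pair -E2 /offset /= in cE dE.
exists c, d => e; split.
- by have := cE 1 0 e; rewrite !mul1r !mul0r ?mulr0 ?addr0 ?add0r.
- by have := cE 0 1 e; rewrite !mul1r !mul0r ?mulr0 ?addr0 ?add0r.
- by have := dE 1 0 e; rewrite !mul1r !mul0r ?mulr0 ?addr0 ?add0r.
- by have := dE 0 1 e; rewrite !mul1r !mul0r ?mulr0 ?addr0 ?add0r.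
Qed.

(** Otherwise the two proportionalities combine to phi i B * phi (i + h) B =
phi i a * phi (i - k) a. *)
Lemma conjugate_zero e1 e2 : alpha i e1 != 0 -> beta i e2 != 0 ->
  forall e, alpha (i + h) e = 0 /\ beta (i + h) e = 0.
Proof.
move=> al be; have [c [d cd]] := conjugate_relations.
have A0 j : phi j (a / B) != 0 by rewrite phi_eq0 mulf_neq0 ?invr_eq0.
have B0' j : phi j B != 0 by rewrite phi_eq0.
have [c0 e|c0] := eqVneq c 0.
  have [-> + _ _] := cd e; rewrite c0 !mul0r => /eqP; rewrite mulf_eq0.
  by rewrite (negPf (A0 _)) => /eqP.
exfalso.
have [E1 _ E2 _] := cd e1; have [_ E3 _ E4] := cd e2.
have dE : d = phi (i - k) (a / B) * c.
  by apply: (mulIf al); rewrite -E2 E1 mulrA.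
have BE : phi i B = phi (i + h) (a / B) * (phi (i - k) (a / B) * phi (i - k) B).
  apply: (mulfI c0); apply: (mulIf be).
  by rewrite -mulrA -E3 E4 dE; ring.
rewrite -phiM mulfVK // in BE.
apply: (@norm_obstruction k (phi i B) (phi (i - k) a) 1) => //.
- by rewrite chi_phi.
- by rewrite -phi_add [h + _]addrC [LHS]phi_add ah.
- exact: oner_neq0.
rewrite phi1 mul1r mulr1 -!phi_add addrC [k + _]addrC subrK BE.
rewrite addrC [h + _]addrC phi_div [phi (i + h) a]phi_add ah.
by rewrite mulrAC mulfVK ?phi_eq0 // mulrC.
Qed.

End Rows.
End Offsets.

(** * The multiplication with independent variables *)

Definition mul (k : 'Z_m) (B a : M) (X U : M * M) : M * M :=
  (phi k X.1 * U.1 + X.1 * phi k U.1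
     + B * (phi k X.2 * U.2 + X.2 * phi k U.2),
   phi (k + h) X.1 * U.2 + X.2 * phi (k + h) U.1
     + a / B * (X.1 * phi (k + h) U.2 + phi (k + h) X.2 * U.1)).

Lemma mulC k B a X U : mul k B a X U = mul k B a U X.
Proof. by rewrite /mul; congr (_, _); ring. Qed.

Definition proj (c : bool) (X : M * M) : M := if c then X.1 else X.2.

Lemma phi_mul k B a r X U :
  phi r.2 (proj r.1 (mul k B a X U)) =
  row_form k B a (fun j V => phi j V.1) (fun j V => phi j V.2) r
    (phi^~ X.1, phi^~ X.2, U).
Proof.
case: r => [[] j]; rewrite /row_form /proj /mul /=;
  by rewrite !(phiD, phiM, phi_add); ring.
Qed.

(** A combination of values of F. With the weights of polar_eval it evaluates
a linear combination of the phi i U.1 and phi i U.2 at independent values. *)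
Definition polar (w1 w2 : M -> M) (F : M * M -> M) : M :=
  \sum_s (w1 s * F (s, 0) + w2 s * F (0, s)).

Section Polar.

Variables (w1 w2 : M -> M).
Implicit Types F G : M * M -> M.
Local Notation pol := (polar w1 w2).

Lemma eq_polar F G : F =1 G -> pol F = pol G.
Proof. by move=> FG; apply: eq_bigr => s _; rewrite !FG. Qed.

Lemma polarD F G : pol (fun U => F U + G U) = pol F + pol G.
Proof. by rewrite -big_split; apply: eq_bigr => s _ /=; ring. Qed.

Lemma polarZ c F : pol (fun U => c * F U) = c * pol F.
Proof. by rewrite mulr_sumr; apply: eq_bigr => s _; ring. Qed.

Lemma polarZr c F : pol (fun U => F U * c) = pol F * c.
Proof. by rewrite mulr_suml; apply: eq_bigr => s _; ring. Qed.

Lemma polar_sum (I : finType) (c : I -> M) (F : I -> M * M -> M) :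
  pol (fun U => \sum_i c i * F i U) = \sum_i c i * pol (F i).
Proof.
rewrite /polar; under eq_bigr => s _ do rewrite !mulr_sumr -big_split /=.
rewrite exchange_big /=; apply: eq_bigr => i _; rewrite mulr_sumr.
by apply: eq_bigr => s _; ring.
Qed.

Lemma polar_row_right k B a al be r xy :
  pol (fun U => row_form k B a al be r (xy, U)) =
  row_form k B a (fun j _ => pol (al j)) (fun j _ => pol (be j)) r (xy, tt).
Proof.
case: r xy => [[] j] [x' y']; rewrite /row_form /=;
  by rewrite !(polarD, polarZ).
Qed.

End Polar.

Lemma polar_eval (x y : 'Z_m -> M) : exists w1 w2 : M -> M,
  (forall i, polar w1 w2 (fun U => phi i U.1) = x i) /\
  (forall i, polar w1 w2 (fun U => phi i U.2) = y i).
Proof.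
have [w1 w1E] := phi_dual x; have [w2 w2E] := phi_dual y; exists w1, w2.
split=> i; rewrite -?w1E -?w2E; apply: eq_bigr => s _ /=; rewrite phi0; ring.
Qed.

Lemma polar_row_left w1 w2 x y k B a (E : Type) (al be : 'Z_m -> E -> M) r e :
  (forall i, polar w1 w2 (fun U => phi i U.1) = x i) ->
  (forall i, polar w1 w2 (fun U => phi i U.2) = y i) ->
  polar w1 w2 (fun Y => row_form k B a al be r (phi^~ Y.1, phi^~ Y.2, e)) =
  row_form k B a al be r (x, y, e).
Proof.
move=> xE yE; case: r => [[] j]; rewrite /row_form /=;
  by rewrite !(polarD, polarZ, polarZr) !xE !yE.
Qed.

Definition is_additive (f : M * M -> M * M) := forall X Y, f (X + Y) = f X + f Y.

Lemma additive_coefs f : is_additive f ->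
  exists n : bool -> bool -> 'Z_m -> M, forall c X,
    proj c (f X) = \sum_(r : bool * 'Z_m) n c r.1 r.2 * phi r.2 (proj r.1 X).
Proof.
move=> fD.
have gD (c d : bool) : exists g : 'Z_m -> M, forall x,
    proj c (f (if d then (x, 0) else (0, x))) = \sum_i g i * phi i x.
  apply: additive_phi => x y.
  have -> : (if d then (x + y, 0) else (0, x + y)) =
    (if d then (x, 0) else (0, x)) + (if d then (y, 0) else (0, y)) :> M * M.
    by case: d; congr (_, _); rewrite /= ?addr0.
  by rewrite fD; case: c.
have [n nE] := fin_all_exists (fun c => fin_all_exists (gD c)).
exists n => c [x y].
have -> : (x, y) = (x, 0) + (0, y) by congr (_, _); rewrite /= ?addr0 ?add0r.
rewrite fD -(pair_bigA _ (fun d i => n c d i * phi i (proj d _))) /=.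
rewrite big_bool /= addr0 add0r -(nE c true x) -(nE c false y).
by case: c.
Qed.

Lemma row_off_edge k B a r j xy e : (forall t, r != edge k j t) ->
  row_form k B a (fun j' (V : M * M) => single j V.1 j')
    (fun j' V => single j V.2 j') r (xy, e) = 0.
Proof.
case: r xy => [c i] [x y] rN.
have ij : i != j by have := rN (c, true); apply: contra_neq => ->.
have ik : i + (if c then k else k + h) != j.
  have := rN (c, false); rewrite /edge /=; apply: contra_neq => <-.
  by congr (_, _); case: (c); rewrite /offset /= addrK.
by case: c ik {rN} => ik; rewrite /row_form /= !single_neq //;
  rewrite !(mulr0, mul0r, addr0).
Qed.

(** * Isotopisms are monomial *)

Lemma edge_inj k i : odd_order k -> k != 0 -> injective (edge k i).
Proof.
move=> kO k0 [c d] [c' d'] [<-].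
have N (b : bool) : i == i + offset k (b, false) = false.
  by rewrite eq_sym -subr_eq0 addrAC subrr add0r (negPf (offset_neq0 kO k0 _)).
case: d d' => [] [] // /eqP; rewrite ?N //.
by rewrite eq_sym N.
Qed.

Section Monomial.

Variables (k1 k2 : 'Z_m) (B1 a1 B2 a2 : M) (N Lam T : M * M -> M * M).
Hypotheses (k1O : odd_order k1) (k10 : k1 != 0).
Hypotheses (k2O : odd_order k2) (k20 : k2 != 0).
Hypotheses (chiB : chi B2 = -1) (a0 : a2 != 0) (ah : phi h a2 = a2).
Hypotheses (ND : is_additive N) (TD : is_additive T).
Hypotheses (Tinj : injective T).
Hypothesis iso : forall Y U, mul k2 B2 a2 Y (T U) = N (mul k1 B1 a1 (Lam Y) U).

(** The coefficients of U in block 0 turn the product on the right into four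
forms, those of the edges at 0, which bounds the rank of the forms al deduced
from T. *)
Lemma isotopism_monomial : exists t (P P' S S' : M), forall U,
  T U = (P * phi t U.1 + P' * phi t U.2, S * phi t U.1 + S' * phi t U.2).
Proof.
have [n nE] := additive_coefs ND; have [c cE] := additive_coefs TD.
have w (e : M * M) := polar_eval (single 0 e.1) (single 0 e.2).
have [w1 [w2 we]] : exists w1 w2 : M * M -> M -> M, forall e,
  (forall i, polar (w1 e) (w2 e) (fun U => phi i U.1) = single 0 e.1 i) /\
  (forall i, polar (w1 e) (w2 e) (fun U => phi i U.2) = single 0 e.2 i).
  have [w1 /fin_all_exists[w2 wE]] := fin_all_exists w.
  by exists w1, w2 => e; exact: wE.
pose ext e := polar (w1 e) (w2 e).
have wP d e i : ext e (fun U => phi i (proj d U)) = single 0 (proj d e) i.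
  by case: (we e) => E1 E2; case: d; [exact: E1 | exact: E2].
pose al d (j : 'Z_m) (e : M * M) := ext e (fun U => phi j (proj d (T U))).
have alE d j e : al d j e = phi j (c d true (- j)) * e.1 + phi j (c d false (- j)) * e.2.
  rewrite /al /ext; under eq_polar => U do
    (rewrite cE phi_sum; under eq_bigr => r _ do rewrite phiM -phi_add).
  rewrite (polar_sum _ _ (fun r => phi j (c d r.1 r.2))
    (fun r U => phi (j + r.2) (proj r.1 U))).
  rewrite -(pair_bigA _ (fun b i =>
    phi j (c d b i) * ext e (fun U => phi (j + i) (proj b U)))) /=.
  have F b : \sum_i phi j (c d b i) * ext e (fun U => phi (j + i) (proj b U)) =
     phi j (c d b (- j)) * proj b e.
    rewrite (bigD1 (- j)) //= wP addrN single_eq big1 ?addr0 // => i ij.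
    by rewrite wP single_neq ?mulr0 // addrC addr_eq0.
  by rewrite big_bool /= !F.
(* The components al d j of T on block 0 of U determine T, so T e = 0 if all
of them vanish at e. *)
have Tal d e : proj d (T e) = \sum_j phi (- j) (al d j e).
  rewrite cE -(pair_bigA _ (fun b i => c d b i * phi i (proj b e))) big_bool /=.
  rewrite -big_split /= (reindex_inj oppr_inj); apply: eq_bigr => j _.
  by rewrite alE phiD !phiM !phiK.
(* Block 0 of U only meets the edges at 0 of the product by Lam Y. *)
have rank4 t : exists f : bool * bool -> M, forall r,
    row_form k2 B2 a2 (al true) (al false) r t =
    \sum_b phi r.2 (n r.1 (edge k1 0 b).1 ((edge k1 0 b).2 - r.2)) * f b.
  case: t => [[x y] e]; have [v1 [v2 [xE yE]]] := polar_eval x y.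
  pose row1 b Y := row_form k1 B1 a1 (fun j V => single 0 V.1 j)
     (fun j V => single 0 V.2 j) (edge k1 0 b) (phi^~ (Lam Y).1, phi^~ (Lam Y).2, e).
  exists (fun b => polar v1 v2 (row1 b)) => r.
  rewrite -(polar_row_left k2 B2 a2 (al true) (al false) r e xE yE) -polar_sum.
  apply: eq_polar => Y.
  have := polar_row_right (w1 e) (w2 e) k2 B2 a2 (fun j U => phi j (T U).1)
    (fun j U => phi j (T U).2) r (phi^~ Y.1, phi^~ Y.2).
  rewrite /row_form /= => <-.
  rewrite -[LHS]/(polar _ _ (fun U => row_form k2 B2 a2 (fun j V => phi j V.1)
     (fun j V => phi j V.2) r (phi^~ Y.1, phi^~ Y.2, T U))).
  under eq_polar => U do rewrite -phi_mul iso nE phi_sum.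
  pose G s := phi r.2 (n r.1 s.1 (s.2 - r.2)).
  have E U : \sum_i phi r.2 (n r.1 i.1 i.2 * phi i.2 (proj i.1 (mul k1 B1 a1 (Lam Y) U)))
    = \sum_s G s * row_form k1 B1 a1 (fun j V => phi j V.1) (fun j V => phi j V.2) s
        (phi^~ (Lam Y).1, phi^~ (Lam Y).2, U).
    rewrite (reindex_inj (h := fun s => (s.1, s.2 - r.2))) /=; last first.
      move=> [s1 s2] [t1 t2] /eqP; rewrite xpair_eqE (inj_eq (addIr _)).
      by case/andP=> /eqP/= -> /eqP/= ->.
    apply: eq_bigr => s _; rewrite phiM -phi_add [r.2 + _]addrC subrK.
    by rewrite phi_mul.
  under eq_polar => U do rewrite E.
  rewrite polar_sum.
  pose row0 s := row_form k1 B1 a1 (fun j V => single 0 V.1 j)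
     (fun j V => single 0 V.2 j) s (phi^~ (Lam Y).1, phi^~ (Lam Y).2, e).
  have row0E s : polar (w1 e) (w2 e) (fun U => row_form k1 B1 a1
      (fun j V => phi j V.1) (fun j V => phi j V.2) s
      (phi^~ (Lam Y).1, phi^~ (Lam Y).2, U)) = row0 s.
    apply: etrans (polar_row_right _ _ _ _ _ _ _ _ _) _.
    by case: s => [[] j]; rewrite /row0 /row_form /= !(we e).1 !(we e).2.
  rewrite (eq_bigr (fun s => G s * row0 s)) => [|s _]; last by rewrite -row0E.
  rewrite (bigID (mem [set edge k1 0 b | b : bool * bool])) /=.
  rewrite big_imset /=; last by move=> b b' _ _; apply: edge_inj.
  rewrite [X in _ + X]big1 ?addr0; first by apply: eq_bigl => b; rewrite inE.
  move=> s /imsetP sN; rewrite /row0 row_off_edge ?mulr0 // => b.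
  by apply/eqP => sE; apply: sN; exists b.
have aB0 := chiN1_neq0 chiB.
have Tinj0 e : e != 0 -> exists j, (al true j e != 0) || (al false j e != 0).
  move=> e0; apply/existsP; apply: contraNT e0 => /existsPn zero.
  have z d j : al d j e = 0.
    have := zero j; rewrite negb_or !negbK => /andP[/eqP z1 /eqP z2].
    by case: d.
  have TD0 : T 0 = 0 by apply: (addrI (T 0)); rewrite -TD !addr0.
  apply/eqP/Tinj; rewrite TD0 [LHS]surjective_pairing.
  rewrite -[(T e).1]/(proj true (T e)) -[(T e).2]/(proj false (T e)) !Tal.
  by rewrite !big1 // => j _; rewrite z phi0.
have [i nz] : exists i, (al true i (1, 0) != 0) || (al false i (1, 0) != 0).
  by apply: Tinj0; rewrite xpair_eqE oner_eq0.
have far := far_zero k2O k20 aB0 a0 rank4 nz.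
(* A linear form in two variables has a nontrivial zero. If one of the two
forms on block i were zero, then at a zero of the other one all components of
T would vanish. *)
have ker d : exists e, e != 0 /\ al d i e = 0.
  pose s := phi i (c d true (- i)); pose s' := phi i (c d false (- i)).
  have [[s0 s'0]|s0] := eqVneq (s, s') 0; [exists (1, 0) | exists (s', - s)].
    by rewrite xpair_eqE oner_eq0 alE /= -/s -/s' s0 s'0 !mul0r addr0.
  rewrite alE /= -/s -/s'; split; last by ring.
  by move: s0; rewrite !xpair_eqE oppr_eq0 andbC.
have [r1 [r2 rE]] := conjugate_relations k2O k20 aB0 a0 rank4 nz.
have A0 j : phi j (a2 / B2) != 0 by rewrite phi_eq0 mulf_neq0 ?invr_eq0.
have at_i e : e != 0 -> al true i e = 0 -> al false i e = 0 -> False.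
  move=> e0 al0 be0; have [j] := Tinj0 e e0.
  have [->|ji] := eqVneq j i; first by rewrite al0 be0 eqxx.
  have [->|jih] := eqVneq j (i + h).
    case: (rE e) => -> _ _ ->; rewrite al0 be0 !mulr0 eqxx //.
  by have [-> ->] := far j ji jih e; rewrite eqxx.
have nonzero d : exists e, al d i e != 0.
  have [e [e0 ze]] := ker (~~ d); exists e; apply/eqP => ze'.
  by case: d ze ze' => ze ze'; apply: (at_i e e0).
have [e1 al1] := nonzero true; have [e2 be2] := nonzero false.
have conj := conjugate_zero k2O k20 aB0 a0 chiB ah rank4 nz al1 be2.
have only_i d j e : j != i -> al d j e = 0.
  move=> ji; have [jih|jih] := eqVneq j (i + h).
    by rewrite jih; case: (conj e) => z1 z2; case: d.
  by have [z1 z2] := far j ji jih e; case: d.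
exists (- i), (c true true (- i)), (c true false (- i)), (c false true (- i)),
  (c false false (- i)) => e.
have TE d : proj d (T e) = phi (- i) (al d i e).
  by rewrite Tal (bigD1 i) //= big1 ?addr0 // => j /only_i ->; rewrite phi0.
rewrite [LHS]surjective_pairing.
rewrite -[(T e).1]/(proj true (T e)) -[(T e).2]/(proj false (T e)) !TE !alE.
by rewrite !phiD !phiM !phiK.
Qed.

End Monomial.

(** * Comparison of the exponents *)

Definition lin2 (f : bool -> bool -> M) (X : M * M) : M * M :=
  (f true true * X.1 + f true false * X.2, f false true * X.1 + f false false * X.2).

Definition phi2 i (X : M * M) : M * M := (phi i X.1, phi i X.2).

(** The coordinate c of the product is bilin of the conjugate of X and of U,
plus bilinT of X and of the conjugate of U; see mul_proj. *)
Definition bilin (c : bool) (B a : M) (X U : M * M) : M :=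
  if c then X.1 * U.1 + B * (X.2 * U.2) else X.1 * U.2 + a / B * (X.2 * U.1).

Definition bilinT (c : bool) (B a : M) (X U : M * M) : M :=
  if c then X.1 * U.1 + B * (X.2 * U.2) else X.2 * U.1 + a / B * (X.1 * U.2).

Lemma mul_proj c k B a X U : let d := if c then k else k + h in
  proj c (mul k B a X U) = bilin c B a (phi2 d X) U + bilinT c B a X (phi2 d U).
Proof. by case: c; rewrite /proj /mul /bilin /bilinT /=; ring. Qed.

Lemma polar_bilin (tr : bool) w1 w2 v1 v2 (x y x' y' : 'Z_m -> M) c B a F G i j :
  (forall i, polar w1 w2 (fun U => phi i U.1) = x i) ->
  (forall i, polar w1 w2 (fun U => phi i U.2) = y i) ->
  (forall i, polar v1 v2 (fun U => phi i U.1) = x' i) ->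
  (forall i, polar v1 v2 (fun U => phi i U.2) = y' i) ->
  let b := if tr then bilinT c B a else bilin c B a in
  polar w1 w2 (fun X => polar v1 v2 (fun U =>
    b (lin2 F (phi2 i X)) (lin2 G (phi2 j U)))) =
  b (lin2 F (x i, y i)) (lin2 G (x' j, y' j)).
Proof.
move=> xE yE x'E y'E b.
have inner X : polar v1 v2 (fun U => b X (lin2 G (phi2 j U))) = b X (lin2 G (x' j, y' j)).
  by rewrite /b /bilin /bilinT; case: tr c {b} => [] [];
    rewrite /lin2 /phi2 /= !(polarD, polarZ) !x'E !y'E.
under eq_polar => X do rewrite inner.
by rewrite /b /bilin /bilinT; case: tr c {b inner} => [] [];
  rewrite /lin2 /phi2 /= !(polarD, polarZ, polarZr) !xE !yE.
Qed.

Section Blocks.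

Variables (k1 k2 : 'Z_m) (B1 a1 B2 a2 : M) (N : M * M -> M * M).
Variables (s t : 'Z_m) (f g : bool -> bool -> M).
Hypotheses (k1O : odd_order k1) (k10 : k1 != 0).
Hypotheses (k2O : odd_order k2) (k20 : k2 != 0).
Hypotheses (ND : is_additive N).
Hypothesis iso : forall X U, N (mul k1 B1 a1 X U) =
  mul k2 B2 a2 (lin2 f (phi2 s X)) (lin2 g (phi2 t U)).

Let tw (d : 'Z_m) (u : bool -> bool -> M) c c' := phi d (u c c').

(** Both sides of the isotopism identity are combinations of products of a
conjugate of X and a conjugate of U, so that it persists for independent
values; here a single block of each argument is nonzero. *)
Lemma block_identity (c : bool) : let d := if c then k2 else k2 + h in
  exists n : bool * 'Z_m -> M, forall i j W V,
  \sum_r n r * row_form k1 B1 a1 (fun j' V => single j V.1 j')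
    (fun j' V => single j V.2 j') r (single i W.1, single i W.2, V) =
  (if (i == s + d) && (j == t) then
     bilin c B2 a2 (lin2 (tw d f) W) (lin2 g V) else 0) +
  (if (i == s) && (j == t + d) then
     bilinT c B2 a2 (lin2 f W) (lin2 (tw d g) V) else 0).
Proof.
move=> d; have [n nE] := additive_coefs ND.
exists (fun r => n c r.1 r.2) => i j W V.
have [w1 [w2 [w1E w2E]]] := polar_eval (single i W.1) (single i W.2).
have [v1 [v2 [v1E v2E]]] := polar_eval (single j V.1) (single j V.2).
pose row r xy := row_form k1 B1 a1 (fun j' U => phi j' U.1) (fun j' U => phi j' U.2) r xy.
have idt X U : \sum_r n c r.1 r.2 * row r (phi^~ X.1, phi^~ X.2, U) =
    bilin c B2 a2 (lin2 (tw d f) (phi2 (s + d) X)) (lin2 g (phi2 t U)) +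
    bilinT c B2 a2 (lin2 f (phi2 s X)) (lin2 (tw d g) (phi2 (t + d) U)).
  under eq_bigr => r _ do rewrite /row -phi_mul.
  rewrite -nE iso mul_proj -/d; congr (_ + _).
    congr bilin; rewrite /lin2 /phi2 /tw /=.
    by rewrite !(phiD, phiM) -!phi_add [d + s]addrC.
  congr bilinT; rewrite /lin2 /phi2 /tw /=.
  by rewrite !(phiD, phiM) -!phi_add [d + t]addrC.
have rowW r : polar w1 w2 (fun X => polar v1 v2 (fun U => row r (phi^~ X.1, phi^~ X.2, U)))
  = row_form k1 B1 a1 (fun j' V => single j V.1 j')
    (fun j' V => single j V.2 j') r (single i W.1, single i W.2, V).
  pose al j' (_ : unit) := single j V.1 j'; pose be j' (_ : unit) := single j V.2 j'.
  rewrite -[RHS]/(row_form k1 B1 a1 al be r (single i W.1, single i W.2, tt)).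
  rewrite -(polar_row_left k1 B1 a1 al be r tt w1E w2E); apply: eq_polar => X.
  apply: etrans (polar_row_right _ _ _ _ _ _ _ _ _) _.
  by case: (r) => [[] j']; rewrite /row_form /= !v1E !v2E.
transitivity (polar w1 w2 (fun X => polar v1 v2 (fun U =>
    \sum_r n c r.1 r.2 * row r (phi^~ X.1, phi^~ X.2, U)))).
  under [RHS]eq_polar => X do rewrite (polar_sum _ _ (fun r => n c r.1 r.2)
    (fun r U => row r (phi^~ X.1, phi^~ X.2, U))).
  by rewrite polar_sum; apply: eq_bigr => r _; rewrite rowW.
under eq_polar => X do under eq_polar => U do rewrite idt.
under eq_polar => X do rewrite polarD.
rewrite polarD (polar_bilin false _ _ _ _ _ _ _ w1E w2E v1E v2E).
rewrite (polar_bilin true _ _ _ _ _ _ _ w1E w2E v1E v2E).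
rewrite /single /= ![_ == i]eq_sym ![_ == j]eq_sym; congr (_ + _).
  by case: (i == _) (j == _) => [] [] //=; rewrite /bilin /lin2 /=;
    case: (c); rewrite !(mulr0, mul0r, addr0).
by case: (i == _) (j == _) => [] [] //=; rewrite /bilinT /lin2 /=;
  case: (c); rewrite !(mulr0, mul0r, addr0).
Qed.

Hypotheses (fS : forall Z, exists W, lin2 f W = Z).
Hypotheses (gS : forall Z, exists W, lin2 g W = Z).

Lemma twist_surj d u : (forall Z, exists W, lin2 u W = Z) ->
  forall Z, exists W, lin2 (tw d u) W = Z.
Proof.
move=> uS [x y]; have [W WE] := uS (phi2 (- d) (x, y)); exists (phi2 d W).
have -> : lin2 (tw d u) (phi2 d W) = phi2 d (lin2 u W).
  by rewrite /lin2 /phi2 /tw /= !(phiD, phiM).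
by rewrite WE /phi2 /= !phiNK.
Qed.

Lemma block_form (c : bool) : let d := if c then k2 else k2 + h in
  exists n : bool * 'Z_m -> M,
  (forall b W V, s + d = t + offset k1 b ->
    bilin c B2 a2 (lin2 (tw d f) W) (lin2 g V) =
    n (edge k1 t b) * edge_pair k1 B1 a1 (fun _ V => V.1) (fun _ V => V.2) t b W.1 W.2 V) /\
  (forall b W V, s = t + d + offset k1 b ->
    bilinT c B2 a2 (lin2 f W) (lin2 (tw d g) V) =
    n (edge k1 (t + d) b) *
      edge_pair k1 B1 a1 (fun _ V => V.1) (fun _ V => V.2) (t + d) b W.1 W.2 V).
Proof.
move=> d; have [n nE] := block_identity c; exists n; rewrite -/d in nE.
have d0 : d != 0 by have := offset_neq0 k2O k20 (c, true).
have add_d x : (x == x + d) = false.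
  by rewrite eq_sym -subr_eq0 addrAC subrr add0r (negPf d0).
have lhs j b (W V : M * M) : let i := j + offset k1 b in
    \sum_r n r * row_form k1 B1 a1 (fun j' V => single j V.1 j')
      (fun j' V => single j V.2 j') r (single i W.1, single i W.2, V) =
    n (edge k1 j b) * edge_pair k1 B1 a1 (fun _ V => V.1) (fun _ V => V.2) j b W.1 W.2 V.
  move=> i; rewrite (bigD1 (edge k1 j b)) // row_edge // big1 => [|r rb].
    by rewrite /= addr0; case: b {i} => [[] []]; rewrite /edge_pair !single_eq.
  case: (boolP [exists b', r == edge k1 j b']) => [|rN].
    case/existsP=> b' /eqP rE; rewrite rE row_edge_other ?mulr0 //.
      by rewrite -subr_eq0 addrAC subrr add0r offset_neq0.
    rewrite (inj_eq (addrI j)) (inj_eq (offset_inj k1O k10)).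
    by apply: contra_neq rb => ->.
  by rewrite row_off_edge ?mulr0 // => b'; apply: contraNneq rN => ->; apply/existsP; exists b'.
have addd x : (x + d == x) = false by rewrite eq_sym add_d.
split=> b W V E.
  by rewrite -lhs -E nE !eqxx addd /= addr0.
by rewrite -lhs -E nE !eqxx add_d /= add0r.
Qed.

Lemma row_far i j W V : (forall b, i != j + offset k1 b) -> forall r,
  row_form k1 B1 a1 (fun j' (V : M * M) => single j V.1 j')
    (fun j' (V : M * M) => single j V.2 j') r (single i W.1, single i W.2, V) = 0.
Proof.
move=> iN r; have [/existsP[b /eqP ->]|rN] := boolP [exists b, r == edge k1 j b].
  have [->|ij] := eqVneq i j; last exact: row_edge_other.
  have N1 (b' : bool * bool) : (j + offset k1 b' == j) = false.
    by rewrite -subr_eq0 addrAC subrr add0r (negPf (offset_neq0 k1O k10 _)).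
  have N2 (b' : bool * bool) : (j == j + offset k1 b') = false.
    by rewrite eq_sym N1.
  have T1 := N1 (true, true); have T2 := N1 (true, false).
  have T3 := N1 (false, true); have T4 := N1 (false, false).
  have T1' := N2 (true, true); have T2' := N2 (true, false).
  have T3' := N2 (false, true); have T4' := N2 (false, false).
  rewrite /offset /= in T1 T2 T3 T4 T1' T2' T3' T4'.
  case: b => [[] []]; rewrite /row_form /edge /offset /= ?subrK !single_eq;
    rewrite !single_neq ?T1 ?T2 ?T3 ?T4 ?T1' ?T2' ?T3' ?T4' //;
    by rewrite !(mulr0, mul0r, addr0).
by rewrite row_off_edge // => b; apply: contraNneq rN => ->; apply/existsP; exists b.
Qed.

(** The block of the right-hand side that comes from the conjugate of L would
vanish if no form on the left were supported there. *)
Lemma block_support :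
  (exists b, s + k2 = t + offset k1 b) /\ (exists b, s = t + k2 + offset k1 b).
Proof.
have [n nE] := block_identity true.
rewrite [if true then k2 else _]/= in nE.
have add_k x : (x == x + k2) = false.
  by rewrite eq_sym -subr_eq0 addrAC subrr add0r (negPf k20).
have addk x : (x + k2 == x) = false by rewrite eq_sym add_k.
split.
  have [/existsP[b /eqP]|] := boolP [exists b, s + k2 == t + offset k1 b].
    by exists b.
  rewrite negb_exists => /forallP N0.
  have [W WE] := twist_surj k2 fS (1, 0); have [V VE] := gS (1, 0).
  have := nE (s + k2) t W V; rewrite big1 => [|r _]; last by rewrite row_far ?mulr0.
  rewrite !eqxx addk WE VE /bilin /= => /eqP.
  by rewrite !(mulr0, addr0, mulr1) eq_sym oner_eq0.
have [/existsP[b /eqP]|] := boolP [exists b, s == t + k2 + offset k1 b].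
  by exists b.
rewrite negb_exists => /forallP N0.
have [W WE] := fS (1, 0); have [V VE] := twist_surj k2 gS (1, 0).
have := nE s (t + k2) W V; rewrite big1 => [|r _]; last by rewrite row_far ?mulr0.
rewrite !eqxx add_k WE VE /bilinT /= => /eqP.
by rewrite !(mulr0, addr0, add0r, mulr1) eq_sym oner_eq0.
Qed.

End Blocks.

(** Doubling removes h. The doubles of the two offsets are then opposite, as
otherwise 4 k2 = 0. *)
Lemma support_match k1 k2 d b1 b2 : odd_order k1 -> k1 != 0 -> odd_order k2 ->
  k2 != 0 -> d + k2 = offset k1 b1 -> d = k2 + offset k1 b2 ->
  (k2 = k1 \/ k2 = - k1) /\ (d = 0 \/ d = h).
Proof.
move=> k1O k10 k2O k20 E1 E2.
have K1O := odd_orderD k1O k1O; have K2O := odd_orderD k2O k2O.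
have dD : (d + d) + (k2 + k2) = k1 + k1 \/ (d + d) + (k2 + k2) = - (k1 + k1).
  by rewrite addrACA E1; apply: offset_dbl.
have dB : (d + d) = (k2 + k2) + (k1 + k1) \/ (d + d) = (k2 + k2) - (k1 + k1).
  by rewrite {1 2 3 4}E2 addrACA; case: (offset_dbl k1 b2) => ->; [left|right].
have K2d : k2 + k2 + (k2 + k2) != 0 := dbl2_neq0 k2O k20.
have dbl_inj i j : odd_order i -> odd_order j -> i + i = j + j -> i = j.
  move=> iO jO ij; apply/eqP; rewrite -subr_eq0; apply/eqP.
  apply: odd_order_dbl; first by apply: odd_orderD iO _; apply: odd_orderN.
  by rewrite addrACA ij -opprD subrr.
have D0 : d + d = 0 /\ (k2 + k2 = k1 + k1 \/ k2 + k2 = - k1 - k1).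
  have KN : - k1 - k1 = - (k1 + k1) by rewrite opprD.
  have N1O := odd_orderN K1O; rewrite KN.
  move: (d + d) (k1 + k1) (k2 + k2) K1O K2O N1O K2d dD dB => D K1 K2 K1O K2O N1O K2d.
  have KE : K2 + K2 = (D + K2) - (D - K2) by ring.
  case=> E3 [] E4.
  - by case/eqP: K2d; rewrite KE E3 E4; ring.
  - have K21 : K2 = K1 by apply: dbl_inj => //; rewrite KE E3 E4; ring.
    by split; [rewrite E4 K21 subrr | left].
  - have K21 : K2 = - K1 by apply: dbl_inj => //; rewrite KE E3 E4; ring.
    by split; [rewrite E4 K21 addNr | right].
  - by case/eqP: K2d; rewrite KE E3 E4; ring.
case: D0 => /dbl_eq0 dd kk; split=> //.
case: kk => [/dbl_inj|/dbl_inj] kk; [left | right]; apply: kk => //.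
exact: odd_orderN.
Qed.

(** * Comparison of the matrices *)

Definition mat2 (a b c d : M) : 'M[M]_2 :=
  \matrix_(i, j) if i == 0 then if j == 0 then a else b
                 else if j == 0 then c else d.

Lemma ord2_ind (Pr : 'I_2 -> Prop) : Pr 0 -> Pr 1 -> forall i, Pr i.
Proof.
by move=> P0 P1 [[|[|i]] lti] //; [have -> : Ordinal lti = 0 | have -> : Ordinal lti = 1];
  try exact: val_inj.
Qed.

Lemma mat2E (A : 'M[M]_2) : A = mat2 (A 0 0) (A 0 1) (A 1 0) (A 1 1).
Proof. by apply/matrixP; do 2!apply: ord2_ind; rewrite mxE. Qed.

Lemma mat2_inj a b c d a' b' c' d' : mat2 a b c d = mat2 a' b' c' d' ->
  [/\ a = a', b = b', c = c' & d = d'].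
Proof.
by move=> /matrixP E; split; [have := E 0 0 | have := E 0 1 | have := E 1 0
  | have := E 1 1]; rewrite !mxE.
Qed.

Lemma mat2M a b c d a' b' c' d' : mat2 a b c d * mat2 a' b' c' d' =
  mat2 (a * a' + b * c') (a * b' + b * d') (c * a' + d * c') (c * b' + d * d').
Proof.
apply/matrixP; do 2!apply: ord2_ind;
  by rewrite !mxE /= big_ord_recl big_ord1 !mxE.
Qed.

Lemma mat2T a b c d : (mat2 a b c d)^T = mat2 a c b d.
Proof. by apply/matrixP; do 2!apply: ord2_ind; rewrite !mxE. Qed.

Lemma mat2Z x a b c d : x *: mat2 a b c d = mat2 (x * a) (x * b) (x * c) (x * d).
Proof. by apply/matrixP; do 2!apply: ord2_ind; rewrite !mxE. Qed.

Definition mphi i (A : 'M[M]_2) : 'M[M]_2 := map_mx (phi i) A.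

Lemma mphi_mat2 i a b c d :
  mphi i (mat2 a b c d) = mat2 (phi i a) (phi i b) (phi i c) (phi i d).
Proof. by apply/matrixP; do 2!apply: ord2_ind; rewrite !mxE. Qed.

Lemma mphi_tr i A : mphi i A^T = (mphi i A)^T.
Proof. by apply/matrixP => j j'; rewrite !mxE. Qed.

Lemma mphiM i A B : mphi i (A * B) = mphi i A * mphi i B.
Proof.
apply/matrixP => j j'; rewrite !mxE phi_sum; apply: eq_bigr => l' _.
by rewrite !mxE phiM.
Qed.

Lemma mphiZ i x A : mphi i (x *: A) = phi i x *: mphi i A.
Proof. by apply/matrixP => j j'; rewrite !mxE phiM. Qed.

Lemma mphi1 i : mphi i 1 = 1.
Proof. by apply/matrixP => j j'; rewrite !mxE; case: eqP; rewrite ?phi1 ?phi0. Qed.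

Lemma mphi_add i j A : mphi (i + j) A = mphi i (mphi j A).
Proof. by apply/matrixP => l' l''; rewrite !mxE phi_add. Qed.

Lemma mphi_unit i A : A \is a GRing.unit -> mphi i A \is a GRing.unit.
Proof.
move=> uA; apply/unitrP; exists (mphi i A^-1).
by rewrite -!mphiM mulVr ?divrr ?mphi1.
Qed.

Definition proportional (A B : 'M[M]_2) := exists2 c, c != 0 & A = c *: B.
Local Notation "A ~~ B" := (proportional A B) (at level 70).

Lemma prop_refl A : A ~~ A.
Proof. by exists 1; rewrite ?oner_eq0 ?scale1r. Qed.

Lemma prop_sym A B : A ~~ B -> B ~~ A.
Proof. by case=> c c0 ->; exists c^-1; rewrite ?invr_eq0 // scalerA mulVf ?scale1r. Qed.

Lemma prop_trans A B C : A ~~ B -> B ~~ C -> A ~~ C.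
Proof. by case=> c c0 -> [d d0 ->]; exists (c * d); rewrite ?mulf_neq0 ?scalerA. Qed.

Lemma propM A B C D : A ~~ B -> C ~~ D -> A * C ~~ B * D.
Proof.
case=> c c0 -> [d d0 ->]; exists (c * d); first by rewrite mulf_neq0.
by rewrite -scalerAl -scalerAr scalerA.
Qed.

Lemma prop_tr A B : A ~~ B -> A^T ~~ B^T.
Proof. by case=> c c0 ->; exists c => //; apply/matrixP => i j; rewrite !mxE. Qed.

Lemma prop_phi i A B : A ~~ B -> mphi i A ~~ mphi i B.
Proof. by case=> c c0 ->; exists (phi i c); rewrite ?phi_eq0 ?mphiZ. Qed.

Lemma prop_cancelr U A B : U \is a GRing.unit -> A * U ~~ B * U -> A ~~ B.
Proof.
by move=> uU /propM/(_ (prop_refl U^-1)); rewrite -!mulrA divrr // !mulr1.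
Qed.

Lemma prop_cancell U A B : U \is a GRing.unit -> U * A ~~ U * B -> A ~~ B.
Proof.
by move=> uU /(propM (prop_refl U^-1)); rewrite !mulrA mulVr // !mul1r.
Qed.

Definition diagB (B : M) := mat2 1 0 0 B.
Definition antiA (A : M) := mat2 0 1 A 0.

Lemma diagB_unit B : B != 0 -> diagB B \is a GRing.unit.
Proof.
move=> B0; apply/unitrP; exists (mat2 1 0 0 B^-1).
have I : 1 = mat2 1 0 0 1 by rewrite [LHS]mat2E !mxE.
by rewrite !mat2M !(mulr0, mul0r, mulr1, addr0, add0r) mulVf ?divff.
Qed.

Lemma tr_unit (A : 'M[M]_2) : A \is a GRing.unit -> A^T \is a GRing.unit.
Proof. by move=> uA; have : A^T \in unitmx by rewrite unitmx_tr. Qed.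

Lemma mat2_col_neq0 (P : 'M[M]_2) j : P \is a GRing.unit -> exists i, P i j != 0.
Proof.
move=> uP; apply/existsP; apply: contraT => /existsPn P0.
have : (P^-1 * P) j j = 0.
  by rewrite mxE big1 // => i _; rewrite (eqP (negbNE (P0 i))) mulr0.
by rewrite mulVr // mxE eqxx => /eqP; rewrite oner_eq0.
Qed.

Section MatrixEquations.

Variables (k t : 'Z_m) (B a1 a2 : M) (P R : 'M[M]_2).
Hypotheses (kO : odd_order k) (chiB : chi B = -1).
Hypotheses (a10 : a1 != 0) (a1h : phi h a1 = a1).
Hypotheses (Bk : phi k B = B).
Hypotheses (uP : P \is a GRing.unit) (uR : R \is a GRing.unit).

Let B0 : B != 0 := chiN1_neq0 chiB.
Let D := diagB B.
Let D1 := diagB (phi t B).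

Let BNk : phi (- k) B = B.
Proof. by rewrite -{1}Bk phiK. Qed.

Let uDR : D * R \is a GRing.unit.
Proof. by rewrite unitrMl // diagB_unit. Qed.

Let DNk : mphi (- k) D = D.
Proof. by rewrite /D /diagB mphi_mat2 phi1 !phi0 BNk. Qed.

(** Eliminating R shows that the conjugates of P by phi k and phi (- k) agree
up to a diagonal matrix and a scalar. The ratio of two entries in different
columns of P is then forbidden by norm_obstruction. *)
Lemma swapped_impossible :
  (mphi k P)^T * (D * R) ~~ antiA (phi t (a1 / B)) ->
  P^T * (D * mphi k R) ~~ (antiA (phi (t + h) (a1 / B)))^T -> False.
Proof.
set A1 := phi t _ => e1 /(prop_phi (- k)).
rewrite !mphiM mphi_tr DNk -mphi_add addNr.
have -> : mphi 0 R = R by apply/matrixP => i j; rewrite mxE phi_0.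
rewrite /antiA mat2T mphi_mat2 phi1 !phi0 => e2.
set A' := phi (- k) _ in e2.
have A10 : A1 != 0 by rewrite phi_eq0 mulf_neq0 ?invr_eq0.
have FE : mat2 0 A' 1 0 = mat2 A' 0 0 A1^-1 * antiA A1.
  by rewrite mat2M !(mulr0, mul0r, mulr1, addr0, add0r) mulVf.
have : (mphi (- k) P)^T * (D * R) ~~ mat2 A' 0 0 A1^-1 * (mphi k P)^T * (D * R).
  apply: prop_trans e2 _; rewrite FE -mulrA; apply: propM (prop_refl _) _.
  exact: prop_sym.
move=> /(prop_cancelr uDR)[c c0]; rewrite (mat2E P).
rewrite !mphi_mat2 !mat2T mat2M mat2Z !(mul0r, addr0, add0r) => /mat2_inj[E00 E01 E10 E11].
have colE0 i : phi (- k) (P i 0) = c * (A' * phi k (P i 0)).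
  by move: i; apply: ord2_ind.
have colE1 i : phi (- k) (P i 1) = c * (A1^-1 * phi k (P i 1)).
  by move: i; apply: ord2_ind.
have [i x0] := mat2_col_neq0 0 uP; have [j y0] := mat2_col_neq0 1 uP.
pose w := P j 1 / P i 0; have w0 : w != 0 by rewrite mulf_neq0 ?invr_eq0.
apply: (norm_obstruction (k := k) (b := phi t B) (e := phi t a1) (w := w)) => //.
- by rewrite chi_phi.
- by rewrite -phi_add addrC phi_add a1h.
have A'0 : A' != 0 by rewrite !phi_eq0 mulf_neq0 ?invr_eq0.
have wE : A1 * A' * phi (- k) w = phi k w.
  rewrite /w !phi_div colE0 colE1; field.
  by rewrite phi_eq0 x0 A'0 c0 A10.
have phiC i' x : phi k (phi i' x) = phi i' (phi k x) by rewrite -!phi_add addrC.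
have phiCt x : phi h (phi t x) = phi t (phi h x) by rewrite -!phi_add addrC.
clearbody w; rewrite phi_add -wE !phiM phiNK [phi k A']phiNK [phi (t + h) _]phi_add.
rewrite /A1 !phi_div a1h phiCt !phiC Bk.
field.
by rewrite !phi_eq0 B0.
Qed.

(** Up to scalars P is fixed by phi k, because it is fixed by phi (k + k) and
k is a multiple of k + k. Eliminating R from the last two equations expresses
the conjugate of P by phi h in two ways through P; together they say that P^T
conjugates diag (j a2, 1) to a multiple of diag (phi t (j a1), 1). *)
Lemma invariant_match :
  phi h a2 = a2 -> a2 != 0 ->
  (mphi k P)^T * (D * R) ~~ D1 -> P^T * (D * mphi k R) ~~ D1 ->
  (mphi (k + h) P)^T * (antiA (a2 / B) * R) ~~ antiA (phi t (a1 / B)) ->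
  P^T * ((antiA (a2 / B))^T * mphi (k + h) R) ~~ (antiA (phi t (a1 / B)))^T ->
  let j a := a ^+ 2 / (B * phi h B) in
  j a2 = phi t (j a1) \/ j a2 * phi t (j a1) = 1.
Proof.
move=> a2h a20 e1 e2 e3 e4 j.
have Pk : mphi k P ~~ P.
  (* Compare the first equation with the second one conjugated by phi (- k).
  *)
  have PkN : mphi k P ~~ mphi (- k) P.
    have := prop_phi (- k) e2; rewrite !mphiM mphi_tr DNk -mphi_add addNr.
    have -> : mphi 0 R = R by apply/matrixP => i i'; rewrite mxE phi_0.
    have -> : mphi (- k) D1 = D1.
      rewrite /D1 /diagB mphi_mat2 phi1 !phi0 -phi_add addrC phi_add.
      by rewrite BNk.
    move=> /prop_sym/(prop_trans e1)/(prop_cancelr uDR)/prop_tr.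
    by rewrite !trmxK.
  have Pkk : mphi (k + k) P ~~ P.
    have := prop_phi k PkN; rewrite -!mphi_add addrN.
    have -> // : mphi 0 P = P by apply/matrixP => i i'; rewrite mxE phi_0.
  have Pit n : mphi ((k + k) *+ n) P ~~ P.
    elim: n => [|n IHn].
      have -> // : mphi 0 P = P by apply/matrixP => i i'; rewrite mxE phi_0.
      exact: prop_refl.
    by rewrite mulrSr mphi_add; apply: prop_trans (prop_phi _ Pkk) IHn.
  have := Pit (l.+1)./2; rewrite -mulr2n -mulrnA.
  by rewrite half_l mulrS (eqP kO) addr0.
have {}e1 : P^T * (D * R) ~~ D1.
  by apply: prop_trans e1; apply: propM (prop_refl _); apply/prop_tr/prop_sym.
have Rk : mphi k R ~~ R.
  have := prop_trans e2 (prop_sym e1); move/(prop_cancell (tr_unit uP)).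
  exact/prop_cancell/diagB_unit.
have e1h : (mphi h P)^T * (mphi h D * mphi h R) ~~ mphi h D1.
  by have := prop_phi h e1; rewrite !mphiM mphi_tr.
have uDRh : mphi h D * mphi h R \is a GRing.unit by rewrite -mphiM mphi_unit.
pose H b := mat2 0 b.1 b.2 0.
have HM b c d : H b * mat2 c 0 0 d = mat2 0 (b.1 * d) (b.2 * c) 0.
  by rewrite mat2M !(mulr0, mul0r, addr0, add0r).
have Bt0 : phi t B != 0 by rewrite phi_eq0.
have Bh0 : phi h B != 0 by rewrite phi_eq0.
have Bth0 : phi h (phi t B) != 0 by rewrite !phi_eq0.
have e3' : (mphi h P)^T * H (B^-1, a2 / B) ~~ H ((phi t B)^-1, phi t (a1 / B)) * P^T.
  have E2 : antiA (a2 / B) = H (B^-1, a2 / B) * D.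
    by rewrite /D /diagB HM /= mulr1 mulVf.
  have E1 : antiA (phi t (a1 / B)) = H ((phi t B)^-1, phi t (a1 / B)) * D1.
    by rewrite /D1 /diagB HM /= mulr1 mulVf.
  apply: (prop_cancelr uDR); rewrite -[X in _ ~~ X]mulrA.
  apply: prop_trans (propM (prop_refl _) (prop_sym e1)).
  rewrite -E1 -[X in X ~~ _]mulrA [H _ * (D * R)]mulrA -E2; apply: prop_trans e3.
  apply: propM (prop_refl _); apply: prop_tr.
  by rewrite addrC mphi_add; apply: prop_phi; apply: prop_sym.
have e4' : P^T * H (a2 / B / phi h B, 1) ~~
    H (phi t (a1 / B) / phi h (phi t B), 1) * (mphi h P)^T.
  have Dh : mphi h D = mat2 1 0 0 (phi h B) by rewrite mphi_mat2 phi1 !phi0.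
  have D1h : mphi h D1 = mat2 1 0 0 (phi h (phi t B)) by rewrite mphi_mat2 phi1 !phi0.
  have E2 : (antiA (a2 / B))^T = H (a2 / B / phi h B, 1) * mphi h D.
    by rewrite Dh HM /= mulr1 mulfVK ?mat2T.
  have E1 : (antiA (phi t (a1 / B)))^T =
      H (phi t (a1 / B) / phi h (phi t B), 1) * mphi h D1.
    by rewrite D1h HM /= mulr1 mulfVK ?mat2T.
  apply: (prop_cancelr uDRh); rewrite -[X in _ ~~ X]mulrA.
  apply: prop_trans (propM (prop_refl _) (prop_sym e1h)).
  rewrite -E1 -[X in X ~~ _]mulrA [H _ * (mphi h D * _)]mulrA -E2; apply: prop_trans e4.
  apply: propM (prop_refl _) _; apply: propM (prop_refl _) _.
  by rewrite addrC mphi_add; apply: prop_phi; apply: prop_sym.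
have := propM e4' (prop_refl (H (B^-1, a2 / B))).
rewrite -[X in X ~~ _]mulrA -[X in _ ~~ X]mulrA => /prop_trans/(_ (propM (prop_refl _) e3')).
rewrite [X in _ ~~ X]mulrA /H !mat2M /= !(mulr0, mul0r, addr0, add0r, mul1r).
case=> c c0; rewrite (mat2E P) mat2T !mat2M mat2Z !(mulr0, mul0r, addr0, add0r).
move=> /mat2_inj[E00 E01 E10 E11].
set u := a2 / B / phi h B * (a2 / B) in E00 E10.
set v := phi t (a1 / B) / phi h (phi t B) * phi t (a1 / B) in E00 E01.
have phiCt x : phi h (phi t x) = phi t (phi h x) by rewrite -!phi_add addrC.
have uj : u = j a2 / B by rewrite /u /j; field; rewrite B0 Bh0.
have vj : v = phi t (j a1) / phi t B.
  rewrite /v /j !expr2 !phi_div !phiM phiCt; field.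
  by rewrite !phi_eq0 B0.
clearbody u v j; rewrite uj vj in E00 E01 E10.
have colP i := mat2_col_neq0 i uP; have rowP' i := mat2_col_neq0 i (tr_unit uP).
(* An invertible P has a nonzero diagonal or a nonzero antidiagonal. *)
have [/andP[p00 p11]|] := boolP ((P 0 0 != 0) && (P 1 1 != 0)).
  left; have cE : c = phi t B / B.
    apply: (mulIf p11); transitivity (phi t B * (c * ((phi t B)^-1 * P 1 1))).
      by field.
    by rewrite -E11; ring.
  apply: (mulIf (invr_neq0 B0)); apply: (mulIf p00); rewrite [LHS]mulrC E00 cE; field.
  by rewrite B0.
rewrite negb_and !negbK => p00_11.
have [p01 p10] : P 0 1 != 0 /\ P 1 0 != 0.
  case/orP: p00_11 => /eqP p0.
    have [i] := colP 0; have [i'] := rowP' 0; rewrite mxE.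
    by move: i i'; apply: ord2_ind; rewrite ?p0 ?eqxx // => i'; move: i';
      apply: ord2_ind; rewrite ?p0 ?eqxx.
  have [i] := colP 1; have [i'] := rowP' 1; rewrite mxE.
  by move: i i'; apply: ord2_ind; rewrite ?p0 ?eqxx // => i'; move: i';
    apply: ord2_ind; rewrite ?p0 ?eqxx.
right; have cE : j a2 / B = c / phi t B.
  by apply: (mulIf p01); rewrite [LHS]mulrC E10 mulrA.
apply: (mulIf (invr_neq0 B0)); apply: (mulIf p10).
transitivity (j a2 / B * phi t (j a1) * P 1 0); first by ring.
transitivity (P 1 0 / B); last by ring.
by rewrite E01 cE; field.
Qed.

End MatrixEquations.

(** * Invariants of isotopic members *)

Definition coef_mx (f : bool -> bool -> M) : 'M[M]_2 :=
  mat2 (f true true) (f true false) (f false true) (f false false).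

Lemma coef_mx_unit f : (forall Z, exists W, lin2 f W = Z) ->
  coef_mx f \is a GRing.unit.
Proof.
move=> fS; have [V [V1 V2]] := fS (1, 0); have [W [W1 W2]] := fS (0, 1).
have : coef_mx f *m mat2 V.1 W.1 V.2 W.2 = 1.
  by rewrite -[LHS]/(_ * _) mat2M V1 V2 W1 W2 [RHS]mat2E !mxE.
by case/mulmx1_unit.
Qed.

Lemma mphi_coef d f :
  mphi d (coef_mx f) = coef_mx (fun c c' => phi d (f c c')).
Proof. exact: mphi_mat2. Qed.

Definition bform (A : 'M[M]_2) (X U : M * M) : M :=
  A 0 0 * (X.1 * U.1) + A 0 1 * (X.1 * U.2) + A 1 0 * (X.2 * U.1)
  + A 1 1 * (X.2 * U.2).

(** The scalar c is nonzero because the left-hand side is invertible. *)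
Lemma bform_prop (A E : 'M[M]_2) u g c :
  (coef_mx u)^T * (A * coef_mx g) \is a GRing.unit ->
  (forall W V, bform A (lin2 u W) (lin2 g V) = c * bform E W V) ->
  (coef_mx u)^T * (A * coef_mx g) ~~ E.
Proof.
move=> uu AE; have E1 : (coef_mx u)^T * (A * coef_mx g) = c *: E.
  rewrite {1}(mat2E A) (mat2E E) /coef_mx mat2T !mat2M mat2Z.
  by congr mat2; [have := AE (1, 0) (1, 0) | have := AE (1, 0) (0, 1)
    | have := AE (0, 1) (1, 0) | have := AE (0, 1) (0, 1)];
    rewrite /bform /lin2 /= !(mulr0, mulr1, mul0r, mul1r, addr0, add0r) => <-; ring.
exists c => //; apply: contraTneq uu => c0; rewrite E1 c0 scale0r.
by rewrite unitr0.
Qed.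

Lemma bform_mat2 a b c d X U : bform (mat2 a b c d) X U =
  a * (X.1 * U.1) + b * (X.1 * U.2) + c * (X.2 * U.1) + d * (X.2 * U.2).
Proof. by rewrite /bform !mxE. Qed.

(** For fixed k and B with phi k B = B, isotopic members have the same
invariant up to conjugation and inversion; see isotopic_parameters. *)
Definition invariant (B a : M) : M := a ^+ 2 / (B * phi h B).

Lemma isotopic_parameters (k1 k2 : 'Z_m) (B a1 a2 : M) (N L T : {perm M * M}) :
  odd_order k1 -> k1 != 0 -> odd_order k2 -> k2 != 0 -> chi B = -1 ->
  phi k1 B = B -> a1 != 0 -> phi h a1 = a1 -> a2 != 0 -> phi h a2 = a2 ->
  is_additive N -> is_additive L -> is_additive T ->
  (forall X U, N (mul k1 B a1 X U) = mul k2 B a2 (L X) (T U)) ->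
  (k2 = k1 \/ k2 = - k1) /\
  (k2 = k1 -> exists t, invariant B a2 = phi t (invariant B a1) \/
                        invariant B a2 * phi t (invariant B a1) = 1).
Proof.
move=> k1O k10 k2O k20 chiB Bk a10 a1h a20 a2h ND LD TD iso.
have [t [g1 [g2 [g3 [g4 TE]]]]] : exists t (P P' S S' : M), forall U,
    T U = (P * phi t U.1 + P' * phi t U.2, S * phi t U.1 + S' * phi t U.2).
  apply: (isotopism_monomial (B1 := B) (a1 := a1) (Lam := (L^-1)%g) k1O k10
    k2O k20 chiB a20 a2h ND TD (@perm_inj _ T)) => Y U.
  by rewrite iso permKV.
have [s [f1 [f2 [f3 [f4 LE]]]]] : exists t (P P' S S' : M), forall U,
    L U = (P * phi t U.1 + P' * phi t U.2, S * phi t U.1 + S' * phi t U.2).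
  apply: (isotopism_monomial (B1 := B) (a1 := a1) (Lam := (T^-1)%g) k1O k10
    k2O k20 chiB a20 a2h ND LD (@perm_inj _ L)) => Y U.
  by rewrite mulC [in RHS]mulC iso permKV.
pose f (c d : bool) := if c then if d then f1 else f2 else if d then f3 else f4.
pose g (c d : bool) := if c then if d then g1 else g2 else if d then g3 else g4.
have {}LE U : L U = lin2 f (phi2 s U) by rewrite LE.
have {}TE U : T U = lin2 g (phi2 t U) by rewrite TE.
have fS Z : exists W, lin2 f W = Z.
  by exists (phi2 s ((L^-1)%g Z)); rewrite -LE permKV.
have gS Z : exists W, lin2 g W = Z.
  by exists (phi2 t ((T^-1)%g Z)); rewrite -TE permKV.
have iso' X U : N (mul k1 B a1 X U) = mul k2 B a2 (lin2 f (phi2 s X)) (lin2 g (phi2 t U)).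
  by rewrite iso LE TE.
have [[b1 sb1] [b2 sb2]] := block_support k1O k10 k20 ND iso' fS gS.
have [kk st] : (k2 = k1 \/ k2 = - k1) /\ (s - t = 0 \/ s - t = h).
  apply: (support_match (b1 := b1) (b2 := b2)) => //.
    by rewrite addrAC sb1 addrAC subrr add0r.
  by rewrite sb2 addrAC [t + _]addrC addrK.
split=> // k21; subst k2; exists t.
have uP := coef_mx_unit fS; have uR := coef_mx_unit gS.
have uA b : b != 0 -> antiA b \is a GRing.unit.
  move=> b0; apply/unitrP; exists (mat2 0 b^-1 1 0).
  rewrite !mat2M !(mulr0, mul0r, mulr1, addr0, add0r) mulVf ?divff //.
  by rewrite [1 in RHS]mat2E !mxE.
have B0 := chiN1_neq0 chiB.
have [n [nE1 nE2]] := block_form k1O k10 k1O k10 ND iso' true.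
have [n' [nE1' nE2']] := block_form k1O k10 k1O k10 ND iso' false.
pose P := coef_mx f; pose R := coef_mx g; pose A2 := a2 / B.
have A20 : A2 != 0 by rewrite mulf_neq0 ?invr_eq0.
have eqn (u v : bool -> bool -> M) (A E : 'M[M]_2) c :
    coef_mx u \is a GRing.unit -> coef_mx v \is a GRing.unit ->
    A \is a GRing.unit ->
    (forall W V, bform A (lin2 u W) (lin2 v V) = c * bform E W V) ->
    (coef_mx u)^T * (A * coef_mx v) ~~ E.
  by move=> uu vu Au; apply: bform_prop; rewrite !unitrMl // tr_unit.
have uD := diagB_unit B0; have uA2 := uA _ A20.
have tw_unit d u : coef_mx u \is a GRing.unit ->
    coef_mx (fun c c' => phi d (u c c')) \is a GRing.unit.
  by move=> uu; rewrite -mphi_coef mphi_unit.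
have uPt d := tw_unit d f uP; have uRt d := tw_unit d g uR.
(* The four equations compare the blocks of the two coordinates when s = t;
the first two do so when s = t + h, where they meet the other type of edge. *)
case: st => [/eqP|/eqP]; rewrite subr_eq => /eqP st.
  rewrite add0r in st.
  have e1 : (mphi k1 P)^T * (diagB B * R) ~~ diagB (phi t B).
    rewrite mphi_coef; apply: eqn => // W V.
    have := nE1 (true, true) W V; rewrite /= st => /(_ erefl).
    rewrite /bilin /= => E; rewrite !bform_mat2 !(mul0r, addr0, mul1r) E.
    by [].
  have e2 : P^T * (diagB B * mphi k1 R) ~~ diagB (phi t B).
    rewrite mphi_coef; apply: eqn => // W V.
    have := nE2 (true, false) W V; rewrite /offset /= addrK st => /(_ erefl).
    rewrite /bilinT /= => E; rewrite !bform_mat2 !(mul0r, addr0, mul1r) E.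
    by [].
  have e3 : (mphi (k1 + h) P)^T * (antiA A2 * R) ~~ antiA (phi t (a1 / B)).
    rewrite mphi_coef; apply: eqn => // W V.
    have := nE1' (false, true) W V; rewrite /= st => /(_ erefl).
    rewrite /bilin /= => E; rewrite !bform_mat2 !(mul0r, addr0, add0r, mul1r) E.
    by [].
  have e4 : P^T * ((antiA A2)^T * mphi (k1 + h) R) ~~ (antiA (phi t (a1 / B)))^T.
    rewrite mphi_coef; apply: eqn => // [|W V]; first exact: tr_unit.
    have := nE2' (false, false) W V; rewrite /offset /= addrK st => /(_ erefl).
    rewrite /bilinT /= => E; rewrite /antiA !mat2T !bform_mat2.
    rewrite !(mul0r, addr0, add0r, mul1r) addrC E.
    by rewrite [in RHS]addrC.
  exact: (invariant_match k1O chiB Bk uP uR a2h a20 e1 e2 e3 e4).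
exfalso.
have e1 : (mphi k1 P)^T * (diagB B * R) ~~ antiA (phi t (a1 / B)).
  rewrite mphi_coef; apply: eqn => // W V.
  have skE : s + k1 = t + (k1 + h) by rewrite st; ring.
  have := nE1 (false, true) W V; rewrite /offset /= -skE => /(_ erefl).
  rewrite /bilin /= => E; rewrite !bform_mat2 !(mul0r, addr0, add0r, mul1r) E.
  by [].
have sE : s = t + k1 - (k1 + h) by rewrite opprD oppr_h addrA addrK st addrC.
have e2 : P^T * (diagB B * mphi k1 R) ~~ (antiA (phi (t + h) (a1 / B)))^T.
  rewrite mphi_coef; apply: (eqn _ _ _ _ (n (edge k1 (t + k1) (false, false)))) => // W V.
  have := nE2 (false, false) W V; rewrite /offset /= -sE => /(_ erefl).
  rewrite /bilinT /antiA mat2T /= => E; rewrite !bform_mat2.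
  rewrite !(mul0r, addr0, add0r, mul1r) E.
  by rewrite [X in _ = _ * X]addrC st [h + t]addrC.
exact: (swapped_impossible k1O chiB a10 a1h Bk uP uR e1 e2).
Qed.

(** * Absence of zero divisors *)

Lemma twisted_ratio_nonsquare j c w : chi c = -1 -> phi j w = c * w -> w = 0.
Proof.
move=> chic E; apply/eqP; apply: contraT => w0.
have := congr1 chi E; rewrite chi_phi chiM chic mulN1r => /eqP.
have : chi w != 0 by rewrite expf_neq0.
rewrite -addr_eq0 => cw; rewrite -mulr2n -mulr_natl mulf_eq0 (negPf cw) orbF.
by rewrite mulr2n addr_eq0 eq_sym (negPf m1_neq1).
Qed.

Section NoZeroDivisors.

Variables (k : 'Z_m) (B a : M).
Hypotheses (kO : odd_order k) (chiB : chi B = -1) (a0 : a != 0) (ah : phi h a = a).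

Let B0 : B != 0 := chiN1_neq0 chiB.

Let chi_ratio : chi (- (a / B)) = -1.
Proof.
rewrite chiN chiM chi_half // mul1r.
by rewrite /chi exprVn -/(chi B) chiB invrN1.
Qed.

Let sym_eq0 x y : x != 0 -> phi k x * y + x * phi k y = 0 -> y = 0.
Proof.
move=> x0 E; apply/eqP; apply: contraT => y0.
have yx0 : y / x != 0 by rewrite mulf_neq0 ?invr_eq0.
have := no_neg_fixed kO yx0; rewrite phi_div -mulNr eqr_div ?phi_eq0 //.
by rewrite mulNr -addr_eq0 addrC [phi k y * x]mulrC [y * _]mulrC E eqxx.
Qed.

(** When x or y is zero, the first equation kills one of u and v, and the
second one makes a nonsquare equal to z^(p^j - 1) where z is the quotient of
the other one by the nonzero coordinate of X. *)
Lemma mul_zero_coord X U : X != 0 -> (X.1 == 0) || (X.2 == 0) ->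
  mul k B a X U = 0 -> U = 0.
Proof.
case: X U => [x y] [u v] /= X0 xy0 [E1 E2].
have aB0 : - (a / B) != 0 := chiN1_neq0 chi_ratio.
have [x0|x0] := eqVneq x 0.
  have y0 : y != 0 by move: X0; rewrite x0 xpair_eqE eqxx.
  move: E1 E2; rewrite x0 !phi0 !(mul0r, add0r) => /eqP.
  rewrite mulf_eq0 (negPf B0) /= => /eqP/(sym_eq0 y0) v0; rewrite v0 => E2.
  congr (_, _); apply/eqP.
  suff /eqP : u / y = 0 by rewrite mulf_eq0 invr_eq0 (negPf y0) orbF.
  apply: (twisted_ratio_nonsquare (j := k + h)) chi_ratio _.
  rewrite phi_div mulrA; apply/eqP; rewrite eqr_div ?phi_eq0 //.
  by rewrite -subr_eq0; apply/eqP; rewrite -[RHS]E2; ring.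
have y0 : y = 0 by apply/eqP; move: xy0; rewrite (negPf x0).
move: E1 E2; rewrite y0 !phi0 !(mul0r, mulr0, addr0) => /(sym_eq0 x0) -> E2.
congr (_, _); apply/eqP.
suff /eqP : v / x = 0 by rewrite mulf_eq0 invr_eq0 (negPf x0) orbF.
apply: (twisted_ratio_nonsquare (j := k + h) (c := (- (a / B))^-1)) _ _.
  by rewrite /chi exprVn -/(chi _) chi_ratio invrN1.
apply: (mulfI aB0); rewrite [RHS]mulVKf // phi_div mulrA.
apply/eqP; rewrite eqr_div ?phi_eq0 // -subr_eq0; apply/eqP.
by apply: oppr_inj; rewrite oppr0 -[RHS]E2; ring.
Qed.

(** If all coordinates are nonzero, put s = u / x, t = v / y, s' = phi h s,
and let f = (t + phi k t) (s' + phi k s') and g = (t + phi k s') (phi k t +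
s'). The first equation says that f is a nonsquare, and both together that g /
f lies in L. But g - f = (t - s') phi k (t - s') is a square, and elements of
L are squares, so f would be a square. *)
Lemma mul_eq0 X U : mul k B a X U = 0 -> X = 0 \/ U = 0.
Proof.
have [->|X0] := eqVneq X 0; first by left.
have [->|U0] := eqVneq U 0; first by right.
move=> E; exfalso.
have [xy0|] := boolP ((X.1 == 0) || (X.2 == 0)).
  by case/eqP: U0; apply: mul_zero_coord xy0 E.
have [uv0|] := boolP ((U.1 == 0) || (U.2 == 0)).
  by case/eqP: X0; rewrite mulC in E; apply: mul_zero_coord uv0 E.
rewrite !negb_or; case: X U E {X0 U0} => [x y] [u v] /= + /andP[u0 v0] /andP[x0 y0].
pose s := u / x; pose t := v / y.
have -> : u = s * x by rewrite mulfVK.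
have -> : v = t * y by rewrite mulfVK.
have s0 : s != 0 by rewrite mulf_neq0 ?invr_eq0.
have t0 : t != 0 by rewrite mulf_neq0 ?invr_eq0.
clearbody s t; clear u v u0 v0.
have fixN z : z != 0 -> z + phi k z != 0.
  by move=> z0; rewrite addrC addr_eq0 no_neg_fixed.
pose sg := s + phi k s; pose ta := t + phi k t.
have sg0 : sg != 0 by apply: fixN.
have ta0 : ta != 0 by apply: fixN.
pose s' := phi h s; have s'0 : s' != 0 by rewrite phi_eq0.
pose P := t + phi k s'; pose R := phi (k + h) t + s.
have phs : phi (k + h) s = phi k s' by rewrite phi_add.
move=> [E1 E2].
have {}E1 : phi k x * x * sg = - (B * (phi k y * y * ta)).
  apply/eqP; rewrite -addr_eq0 -[X in _ == X]E1 /sg /ta !phiM; apply/eqP; ring.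
have {}E2 : phi (k + h) x * y * P = - (a / B * (x * phi (k + h) y * R)).
  apply/eqP; rewrite -addr_eq0 -[X in _ == X]E2 /P /R !phiM phs; apply/eqP; ring.
pose f := ta * phi h sg; pose g := P * phi h R.
have chiphi z : chi (phi k z * z) = chi z ^+ 2 by rewrite chiM chi_phi expr2.
have chif : chi f = -1.
  have := congr1 chi E1; rewrite chiN !chiM !chi_phi chiB.
  rewrite -!expr2 !chi_sqr // !mul1r mulN1r => ->.
  by rewrite mulrN -expr2 chi_sqr.
have hk z : phi h (phi (k + h) z) = phi k z.
  by rewrite -phi_add addrCA hh0 addr0.
have phR : phi h R = phi k t + s' by rewrite phiD hk.
have gE : g = f + (t - s') * phi k (t - s').
  rewrite /g /f phR /P /ta /sg phiD -/s' phiB.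
  have -> : phi h (phi k s) = phi k s' by rewrite -!phi_add addrC.
  ring.
(* If P = 0 then R = 0, and s' is fixed by phi k: then f is minus a square. *)
have P0 : P != 0.
  apply/negP => /eqP P0; move: E2; rewrite P0 mulr0 => /esym/eqP.
  rewrite oppr_eq0 !mulf_eq0 invr_eq0 (negPf a0) (negPf B0) (negPf x0) phi_eq0 (negPf y0) /=.
  move=> /eqP R0.
  have tE : t = - phi k s' by apply/eqP; rewrite -addr_eq0 -/P P0.
  have sE : s' = - phi k t by apply/eqP; rewrite -addr_eq0 addrC -phR R0 phi0.
  have s'k : phi k s' = s'.
    by apply: phi_dbl_fixed kO _; rewrite phi_add {2}sE tE !phiN opprK.
  have f_sqr : f = - (phi h sg) ^+ 2.
    have -> : f = - (phi h sg) * phi h sg; last by rewrite mulNr -expr2.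
    congr (_ * _); rewrite /ta tE /sg phiD phiN s'k -/s' s'k.
    have -> : phi h (phi k s) = phi k s' by rewrite -!phi_add addrC.
    by rewrite s'k opprD.
  move: chif; rewrite f_sqr chiN chi_expn2 ?phi_eq0 // => /eqP.
  by rewrite eq_sym (negPf m1_neq1).
(* Multiply the two equations: the quotient of the conjugates of x and y that
appears is a norm to L, hence fixed by phi h. *)
have cross : f * phi h g = phi h f * g.
  have E3 : phi (k + h) x * phi k x * sg * P = a * ta * R * (phi (k + h) y * phi k y).
    apply: (mulfI (mulf_neq0 x0 y0)).
    transitivity ((phi k x * x * sg) * (phi (k + h) x * y * P)); first by ring.
    rewrite E1 E2; field; exact: B0.
  have hk' z : phi h (phi k z) = phi (k + h) z by rewrite -phi_add addrC.
  have := congr1 (phi h) E3; rewrite !phiM !hk !hk' ah => E4.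
  rewrite /f /g ?phiM !phi_hK.
  have xx0 : phi (k + h) x * phi k x != 0 by rewrite mulf_neq0 ?phi_eq0.
  apply: (mulfI xx0).
  transitivity (ta * R * (phi k x * phi (k + h) x * phi h sg * phi h P)); first by ring.
  rewrite E4.
  transitivity (phi h ta * phi h R * (phi (k + h) x * phi k x * sg * P)); last by ring.
  by rewrite E3; ring.
have f0 : f != 0 by apply: chiN1_neq0 chif.
have [e0|e0] := eqVneq (t - s') 0.
  move: chif; have ts : t = s' by apply/eqP; rewrite -subr_eq0 e0.
  have -> : f = (phi h sg) ^+ 2.
    rewrite expr2 /f; congr (_ * _); rewrite /ta /sg phiD ts -/s'.
    by congr (_ + _); rewrite -!phi_add addrC.
  rewrite chi_expn2 ?phi_eq0 // => /eqP.
  by rewrite eq_sym (negPf m1_neq1).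
have eta_h : phi h (g / f - 1) = g / f - 1.
  rewrite phiB phi1 phi_div; congr (_ - _); apply/eqP.
  by rewrite eqr_div ?phi_eq0 // mulrC cross mulrC.
have etaE : g / f - 1 = (t - s') * phi k (t - s') / f.
  by rewrite gE mulrDl divff // addrAC subrr add0r.
have eta0 : g / f - 1 != 0 by rewrite etaE !mulf_neq0 ?invr_eq0 ?phi_eq0.
have : chi ((t - s') * phi k (t - s')) = chi ((g / f - 1) * f).
  by rewrite etaE mulfVK.
rewrite [RHS]chiM (chi_half eta0 eta_h) chif mul1r.
rewrite [LHS]chiM chi_phi -expr2 chi_sqr // => /eqP.
by rewrite eq_sym (negPf m1_neq1).
Qed.

End NoZeroDivisors.

(** * Isotopies within the family *)

Lemma mulSE k B a X U : mulS p m k B a (X, U) = mul k%:R B a X U.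
Proof.
by case: X U => [x y] [u v]; rewrite ffunE /mul -natrD !phiE.
Qed.

Lemma mulDl k B a U : is_additive (mul k B a ^~ U).
Proof. by move=> X Y; congr (_, _); rewrite /= !phiD; ring. Qed.

Lemma mulDr k B a X : is_additive (mul k B a X).
Proof. by move=> U V; rewrite ![mul _ _ _ X _]mulC mulDl. Qed.

Lemma mulS_presemifield (k : nat) B a : odd_order k%:R -> chi B = -1 -> a != 0 ->
  phi h a = a -> is_presemifield (mulS p m k B a).
Proof.
move=> kO chiB a0 ah; apply/and3P; split.
- by apply/'forall_'forall_forallP => X Y U; rewrite !mulSE mulDl.
- by apply/'forall_'forall_forallP => X U W; rewrite !mulSE mulDr.
apply/'forall_forallP => X U; rewrite mulSE; apply/implyP => /eqP.
by case/(mul_eq0 kO chiB a0 ah) => ->; rewrite eqxx ?orbT.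
Qed.

Lemma Fp_linearP (f : M * M -> M * M) : reflect (is_additive f) (Fp_linear p f).
Proof.
apply: (iffP idP) => [/forallP/(_ 1)/forallP fL X Y | fD].
  have /forallP/(_ Y)/eqP := fL X.
  by rewrite /= modn_small // !mulr1n.
have f0 : f 0 = 0 by apply: (addrI (f 0)); rewrite -fD !addr0.
apply/'forall_'forall_forallP => c X Y; rewrite fD; apply/eqP; congr (_ + _).
by elim: (c : nat) => [|n IHn]; rewrite ?mulr0n // !mulrS fD IHn.
Qed.

Lemma isotopicP (op1 op2 : multiplication (M * M)%type) :
  reflect (exists N L T : {perm M * M},
    [/\ is_additive N, is_additive L, is_additive T
      & forall X U, N (op1 (X, U)) = op2 (L X, T U)]) (isotopic p op1 op2).
Proof.
apply: (iffP existsP) => [[N /existsP[L /existsP[T /and4P[]]]] | [N [L [T []]]]].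
  move=> /Fp_linearP ND /Fp_linearP LD /Fp_linearP TD /'forall_forallP iso.
  by exists N, L, T; split=> // X U; apply/eqP.
move=> /Fp_linearP ND /Fp_linearP LD /Fp_linearP TD iso.
exists N; apply/existsP; exists L; apply/existsP; exists T; rewrite ND LD TD /=.
by apply/'forall_forallP => X U; apply/eqP.
Qed.

Lemma isotopic_equivalence : equivalence_rel (isotopic p (V := (M * M)%type)).
Proof.
have refl (op : multiplication (M * M)%type) : isotopic p op op.
  by apply/isotopicP; exists 1%g, 1%g, 1%g; split=> [X Y|X Y|X Y|X U]; rewrite !perm1.
have sym (op1 op2 : multiplication (M * M)%type) : isotopic p op1 op2 -> isotopic p op2 op1.
  case/isotopicP=> N [L [T [ND LD TD iso]]]; apply/isotopicP.
  have invD (f : {perm M * M}) : is_additive f -> is_additive (f^-1)%g.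
    by move=> fD X Y; apply: (@perm_inj _ f); rewrite fD !permKV.
  exists N^-1%g, L^-1%g, T^-1%g; split; try exact: invD.
  by move=> X U; apply: (@perm_inj _ N); rewrite iso !permKV.
have trans (op2 op1 op3 : multiplication (M * M)%type) :
    isotopic p op1 op2 -> isotopic p op2 op3 -> isotopic p op1 op3.
  case/isotopicP=> N [L [T [ND LD TD iso]]] /isotopicP[N' [L' [T' [ND' LD' TD' iso']]]].
  apply/isotopicP; exists (N * N')%g, (L * L')%g, (T * T')%g.
  by split=> [X Y|X Y|X Y|X U]; rewrite !permM ?ND ?ND' ?LD ?LD' ?TD ?TD' ?iso ?iso'.
move=> x y z; split; first exact: refl.
by move=> xy; apply/idP/idP; [apply: trans; exact: sym | exact: trans].
Qed.

Lemma isotopicI (op1 op2 : multiplication (M * M)%type) (N L T : M * M -> M * M) :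
  injective N -> injective L -> injective T ->
  is_additive N -> is_additive L -> is_additive T ->
  (forall X U, N (op1 (X, U)) = op2 (L X, T U)) -> isotopic p op1 op2.
Proof.
move=> Ni Li Ti ND LD TD iso; apply/isotopicP.
exists (perm Ni), (perm Li), (perm Ti).
by split=> [X Y|X Y|X Y|X U]; rewrite !permE.
Qed.

(** If x = d^2, the alternating product of the phi (k *+ i) d for i < l
telescopes, as l is odd, to c with phi k c * c = d * phi (k *+ l) d = d^2. *)
Lemma twisted_square_root k x : odd_order k -> chi x = 1 ->
  exists c, phi k c * c = x.
Proof.
move=> kO chix; have x0 : x != 0.
  by apply: contra_eq_neq chix => ->; rewrite chi0 eq_sym oner_neq0.
have /existsP[d /eqP xd] := chi1_is_square chix.
have d0 : d != 0 by move: x0; rewrite xd expf_eq0.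
pose F i := if odd i then (phi (k *+ i) d)^-1 else phi (k *+ i) d.
have tele n : phi k (\prod_(i < n) F i) * \prod_(i < n) F i =
    d * (if odd n then phi (k *+ n) d else (phi (k *+ n) d)^-1).
  elim: n => [|n IHn]; first by rewrite !big_ord0 phi1 mulr0n phi_0 mulr1 divff.
  rewrite !big_ord_recr phiM /= mulrACA IHn /F; case: (odd n) => /=.
    rewrite phiV -phi_add -mulrS; field.
    by rewrite !phi_eq0 d0.
  rewrite -phi_add -mulrS; field.
  by rewrite !phi_eq0 d0.
exists (\prod_(i < l) F i); rewrite tele odd_l (eqP kO) phi_0 xd.
by rewrite expr2.
Qed.

(** Scale all second coordinates by some c with phi k c * c = B / B2. *)
Lemma isotopic_change_B (k : nat) B B2 a : odd_order k%:R -> chi B = -1 ->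
  chi B2 = -1 -> a != 0 -> phi h a = a ->
  exists a2, [/\ a2 != 0, phi h a2 = a2
    & isotopic p (mulS p m k B a) (mulS p m k B2 a2)].
Proof.
move=> kO chiB chiB2 a0 ah; have B0 := chiN1_neq0 chiB.
have B20 := chiN1_neq0 chiB2; pose q : 'Z_m := k%:R.
have [|c cE] := @twisted_square_root k%:R (B / B2) kO.
  by rewrite chiM chiB /chi exprVn -/(chi B2) chiB2 invrN1 mulrNN mulr1.
have c0 : c != 0.
  have : B / B2 != 0 by rewrite mulf_neq0 ?invr_eq0.
  by rewrite -cE mulf_eq0 negb_or => /andP[].
pose a2 := a / phi q (c * phi h c); exists a2; split.
- by rewrite mulf_neq0 ?invr_eq0 ?phi_eq0 ?mulf_neq0 ?phi_eq0.
- rewrite /a2 phi_div ah -!phi_add [h + q]addrC phi_add phiM phi_hK.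
  by rewrite [phi h c * c]mulrC.
pose S (X : M * M) := (X.1, c * X.2).
have Si : injective S by move=> [x y] [x' y'] [-> /(mulfI c0) ->].
have SD : is_additive S by move=> X Y; congr (_, _); rewrite /= mulrDr.
apply: (isotopicI (N := S) (L := S) (T := S)) => // X U.
rewrite !mulSE -/q /mul /S /= !phiM; congr (_, _).
  have -> : B = B2 * (phi q c * c) by rewrite cE mulrC mulfVK.
  ring.
have -> : B = B2 * (phi q c * c) by rewrite cE mulrC mulfVK.
rewrite /a2 phiM -phi_add; field.
by rewrite !phi_eq0 B20 c0.
Qed.

(** Apply the inverses of the two automorphisms phi k and phi (k + h) to the
two coordinates of the product. *)
Lemma isotopic_opposite (k : nat) B a : (k <= m)%N -> chi B = -1 ->
  a != 0 -> phi h a = a ->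
  exists B2 a2, [/\ chi B2 = -1, a2 != 0, phi h a2 = a2
    & isotopic p (mulS p m k B a) (mulS p m (m - k) B2 a2)].
Proof.
move=> km chiB a0 ah; have B0 := chiN1_neq0 chiB; pose q : 'Z_m := k%:R.
have mk : (m - k)%:R = - q :> 'Z_m by rewrite natrB // pchar_Zp // sub0r.
pose A := a / B; have A0 : A != 0 by rewrite mulf_neq0 ?invr_eq0.
pose B2 := phi (- q) B; pose a2 := B2 / phi (- (q + h)) A.
have hq z : phi h (phi (- q) z) = phi (- (q + h)) z.
  by rewrite -phi_add opprD oppr_h addrC.
exists B2, a2; split.
- by rewrite chi_phi.
- by rewrite mulf_neq0 ?invr_eq0 ?phi_eq0.
- have haq : phi h (phi (- q) a) = phi (- q) a.
    by rewrite -phi_add addrC phi_add ah.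
  rewrite /a2 -hq phi_div phi_hK /B2 /A !phi_div haq; field.
  by rewrite !phi_eq0 a0 B0.
pose N (Z : M * M) := (phi (- q) Z.1, phi (- (q + h)) Z.2 / phi (- (q + h)) A).
apply: (isotopicI (N := N) (L := id) (T := id)) => //.
- move=> [x y] [x' y'] [/phi_inj -> E].
  by rewrite (phi_inj (mulIf (invr_neq0 _) E)) // phi_eq0.
- by move=> X Y; congr (_, _); rewrite /= phiD ?mulrDl.
move=> X U; rewrite !mulSE mk /mul /N /=.
have -> : - q + h = - (q + h) by rewrite opprD oppr_h.
rewrite -/q -/A; clearbody A; rewrite !(phiD, phiM) -!phi_add.
rewrite ![- q + q]addNr ![- (q + h) + (q + h)]addNr !phi_0; congr (_, _).
  by rewrite -/B2; ring.
rewrite /a2.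
field.
by rewrite !phi_eq0 A0 B0.
Qed.

(** * Counting isotopy classes *)

#[local] Opaque isotopic is_presemifield.

Local Notation d := (2 ^ logn 2 m)%N.

Lemma m_decomp : m = (l * d)%N.
Proof. by rewrite /odd_part divnK // pfactor_dvdnn. Qed.

Lemma odd_quotient k : (0 < k)%N -> odd (m %/ gcdn k m) = (d %| k)%N.
Proof.
move=> k0; have m0 : (0 < m)%N by lia.
apply/idP/idP => [oq | /dvdnP[j ->]].
  have g0 : (0 < gcdn k m)%N by rewrite gcdn_gt0 k0.
  apply: dvdn_trans (dvdn_gcdl k m).
  rewrite -(@Gauss_dvdr _ (m %/ gcdn k m)) ?divnK ?dvdn_gcdr // ?pfactor_dvdnn //.
  by rewrite coprimeXl // coprime2n.
have d0 : (0 < d)%N by rewrite expn_gt0.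
move: d l d0 m_decomp odd_l => D L D0 -> oL.
rewrite -muln_gcdl divnMr //; apply: dvdn_odd oL.
by rewrite dvdn_div ?dvdn_gcdr.
Qed.

Lemma dvdn_neq_half k : (d %| k)%N -> (2 * k)%N != m.
Proof.
case/dvdnP=> j ->; rewrite mulnA [X in _ != X]m_decomp eqn_pmul2r ?expn_gt0 //.
by apply: contraTneq odd_l => <-; rewrite mul2n odd_double.
Qed.

Lemma odd_order_nat k : (d %| k)%N -> odd_order k%:R.
Proof.
case/dvdnP=> j ->; rewrite /odd_order -mulrnA -mulnA [(d * _)%N]mulnC.
by rewrite -m_decomp natrM pchar_Zp // mulr0.
Qed.

Lemma natr_Zm_neq0 k : (0 < k < m)%N -> k%:R != 0 :> 'Z_m.
Proof.
move=> /andP[k0 km]; apply/eqP => /(congr1 (@nat_of_ord _)).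
by rewrite val_Zp_nat //= modn_small; lia.
Qed.

Lemma natr_Zm_half_inj (k k' : nat) : (0 < k)%N -> (2 * k < m)%N ->
  (2 * k' < m)%N -> k'%:R = k%:R :> 'Z_m \/ k'%:R = - k%:R :> 'Z_m -> k' = k.
Proof.
move=> k0 km k'm; have val_lt i : (i < m)%N -> (i%:R : 'Z_m) = i :> nat.
  by move=> im; rewrite val_Zp_nat // modn_small.
case=> [/(congr1 (@nat_of_ord _))|/eqP]; first by rewrite !val_lt //; lia.
rewrite -addr_eq0 -natrD => /eqP/(congr1 (@nat_of_ord _)).
by rewrite val_lt /=; lia.
Qed.

(** The norm of a nonsquare down to the subfield of order p^(2^e), where 2^e
is the 2-part of m; the degree is odd. *)
Lemma ex_fixed_nonsquare : exists B, chi B = -1 /\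
  forall k, (d %| k)%N -> phi k%:R B = B.
Proof.
have [g gN] := ex_nonsquare; exists (norm_k d%:R g); split.
  exact: chi_norm_k.
move=> k /dvdnP[j ->]; elim: j => [|j IHj]; first by rewrite mul0n phi_0.
rewrite mulSn natrD phi_add IHj norm_k_fixed //.
by rewrite odd_order_nat.
Qed.

(** One exponent from each pair k, m - k of admissible exponents. *)
Definition half_exponents : {set 'I_m} :=
  [set k : 'I_m | [&& (0 < k)%N, odd (m %/ gcdn k m) & (2 * k < m)%N]].

Lemma card_half_exponents : #|half_exponents| = l./2.
Proof.
have d0 : (0 < d)%N by rewrite expn_gt0.
have lt_f (i : 'I_(l./2)) : (i.+1 * d < m)%N.
  rewrite [X in (_ < X)%N]m_decomp ltn_pmul2r //.
  by have := ltn_ord i; have := odd_l; lia.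
pose f i : 'I_m := Ordinal (lt_f i).
have fi : injective f.
  move=> i j /(congr1 val) /= /eqP; rewrite eqn_pmul2r // => /eqP[].
  exact: val_inj.
rewrite -[RHS]card_ord -(card_imset _ fi); apply: eq_card => k; rewrite inE.
apply/and3P/imsetP => [[k0 ok k2] | [i _ ->]].
  rewrite odd_quotient // in ok; have [j kE] := dvdnP ok.
  have j0 : (0 < j)%N by move: k0; rewrite kE muln_gt0 => /andP[].
  have jl : (j.-1 < l./2)%N.
    move: k2; rewrite kE mulnA [X in (_ < X)%N -> _]m_decomp ltn_pmul2r //.
    by have := odd_l; lia.
  by exists (Ordinal jl) => //; apply: val_inj; rewrite /= prednK.
rewrite /= muln_gt0 d0 odd_quotient ?muln_gt0 ?d0 // dvdn_mull //; split=> //.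
rewrite mulnA [X in (_ < X)%N]m_decomp ltn_pmul2r //.
by have := ltn_ord i; have := odd_l; lia.
Qed.

Definition half_units : {set M} := [set a : M | (a != 0) && (phi h a == a)].

Definition members : {set multiplication (M * M)%type} :=
  [set op | [exists k : 'I_m, exists B : M, exists a : M,
    [&& (0 < k)%N, odd (m %/ gcdn k m), B != 0, ~~ is_square B,
        a != 0, in_half_subfield p m a & op == mulS p m k B a]]].

Definition member_classes : {set {set multiplication (M * M)%type}} :=
  [set C in isotopy_classes p (M * M)%type | [exists op in members, op \in C]].

Lemma eq_equivalence_class (T : finType) (R : rel T) (D : {set T}) x y :
  equivalence_rel R -> y \in D ->
  ([set z in D | R x z] == [set z in D | R y z]) = R x y.
Proof.
move=> eqv yD; apply/eqP/idP => [/setP/(_ y)|xy].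
  by rewrite !inE yD /= => ->; have [] := eqv y y y.
by apply/setP => z; rewrite !inE; have [_ /(_ xy) ->] := eqv x y z.
Qed.

Definition class_of (op : multiplication (M * M)%type) :=
  [set op' in [set op' | is_presemifield op'] | isotopic p op op'].

Lemma mem_members (k : 'I_m) B a : (0 < k)%N -> odd (m %/ gcdn k m) ->
  chi B = -1 -> a \in half_units -> mulS p m k B a \in members.
Proof.
move=> k0 ok chiB; rewrite inE => /andP[a0 /eqP ah]; rewrite inE.
apply/existsP; exists k; apply/existsP; exists B; apply/existsP; exists a.
rewrite k0 ok (chiN1_neq0 chiB) a0 /in_half_subfield -phiE ah !eqxx /= andbT.
apply/existsP => -[c /eqP E]; have := chiB; rewrite E chi_expn2 => [/eqP|].
  by rewrite eq_sym (negPf m1_neq1).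
by have := chiN1_neq0 chiB; rewrite E expf_eq0.
Qed.

Lemma class_of_classes op : is_presemifield op ->
  class_of op \in isotopy_classes p (M * M)%type.
Proof. by move=> pop; apply/imsetP; exists op; rewrite ?inE. Qed.

Lemma eq_class_of op op' : is_presemifield op' ->
  (class_of op == class_of op') = isotopic p op op'.
Proof.
move=> pop; apply: eq_equivalence_class; first exact: isotopic_equivalence.
by rewrite inE.
Qed.

Definition parameters : {set 'I_m * M} := setX half_exponents half_units.

Lemma card_parameters : #|parameters| = (l./2 * (Q - 1))%N.
Proof. by rewrite cardsX card_half_exponents card_half. Qed.

Lemma card_invariant_fibre B v : B != 0 -> (#|[set a | invariant B a == v]| <= 2)%N.
Proof.
move=> B0; have [->|[b]] := set_0Vmem [set a | invariant B a == v].
  by rewrite cards0.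
rewrite inE => /eqP bv; apply: leq_trans (_ : #|[set b; - b]| <= 2)%N.
  apply: subset_leq_card; apply/subsetP => a; rewrite !inE -bv => /eqP.
  move/(mulIf _); rewrite invr_eq0 mulf_neq0 ?phi_eq0 // => /(_ isT)/eqP.
  by rewrite eqf_sqr.
by rewrite cards2; case: (_ != _).
Qed.

(** The candidates for a2 left by isotopic_parameters. *)
Definition related (B a : M) : {set M} :=
  [set a2 | [exists t, (invariant B a2 == phi t (invariant B a)) ||
     (invariant B a2 * phi t (invariant B a) == 1)]].

(** The invariant of a lies in L, so its conjugate by phi t only depends on t
modulo m / 2; and a^2 determines a up to sign. *)
Lemma card_related (B a : M) : B != 0 -> a != 0 -> phi h a = a ->
  (#|related B a| <= 2 * m)%N.
Proof.
move=> B0 a0 ah; pose j := invariant B a.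
have jh : phi h j = j.
  by rewrite /j /invariant phi_div phiM phi_hK phiX ah [phi h B * B]mulrC.
have j0 : j != 0 by rewrite mulf_neq0 ?expf_neq0 ?invr_eq0 ?mulf_neq0 ?phi_eq0.
pose V1 : {set M} := [set phi t j | t : 'Z_m].
have V1le : (#|V1| <= m %/ 2)%N.
  rewrite -[X in (_ <= X)%N]card_ord.
  apply: leq_trans (leq_imset_card (fun i : 'I_(m %/ 2) => phi (i : nat)%:R j) predT).
  apply: subset_leq_card; apply/subsetP => _ /imsetP[t _ ->].
  have tm : (t < m)%N by rewrite -[X in (_ < X)%N](Zp_cast m_gt1) ltn_ord.
  have [tlt|tge] := ltnP t (m %/ 2).
    by apply/imsetP; exists (Ordinal tlt); rewrite // natr_Zp.
  have tlt : (t - m %/ 2 < m %/ 2)%N by lia.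
  apply/imsetP; exists (Ordinal tlt) => //=.
  by rewrite natrB // natr_Zp -oppr_h opprK phi_add jh.
pose V := V1 :|: [set v^-1 | v in V1].
have Vle : (#|V| <= m)%N.
  apply: leq_trans (leq_card_setU _ _) _.
  by apply: leq_trans (leq_add V1le (leq_trans (leq_imset_card _ _) V1le)) _; lia.
apply: leq_trans (_ : #|\bigcup_(v in V) [set a2 | invariant B a2 == v]| <= _)%N.
  apply: subset_leq_card; apply/subsetP => a2; rewrite inE => /existsP[t /orP ta].
  have tV1 : phi t j \in V1 by apply/imsetP; exists t.
  case: ta => /eqP ta.
    by apply/bigcupP; exists (phi t j); rewrite ?inE ?tV1 // ta.
  apply/bigcupP; exists (phi t j)^-1.
    by rewrite inE; apply/orP; right; apply/imsetP; exists (phi t j).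
  rewrite inE; apply/eqP; apply: (mulIf (_ : phi t j != 0)); rewrite ?phi_eq0 //.
  by rewrite ta mulVf ?phi_eq0.
have bigle : (#|\bigcup_(v in V) [set a2 | invariant B a2 == v]| <=
    \sum_(v in V) #|[set a2 | invariant B a2 == v]|)%N.
  elim/big_rec2: _ => [|v s S _ IH]; first by rewrite cards0.
  by apply: leq_trans (leq_card_setU _ _) _; rewrite leq_add2l.
apply: leq_trans bigle _.
apply: leq_trans (_ : \sum_(v in V) 2 <= _)%N.
  by apply: leq_sum => v _; apply: card_invariant_fibre.
by rewrite sum_nat_const mulnC leq_mul2l Vle.
Qed.

Lemma mulS_normal_form (k : 'I_m) B1 B a : (0 < k)%N -> odd (m %/ gcdn k m) ->
  chi B1 = -1 -> chi B = -1 -> a \in half_units ->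
  exists (k' : 'I_m) a', [/\ k' \in half_exponents, a' \in half_units
    & isotopic p (mulS p m k B1 a) (mulS p m k' B a')].
Proof.
move=> k0 ok chiB1 chiB; rewrite inE => /andP[a0 /eqP ah].
rewrite odd_quotient // in ok; have kO := odd_order_nat ok.
have km := ltn_ord k; have [k2|k2] := ltnP (2 * k) m.
  have [a2 [a20 a2h iso]] := isotopic_change_B kO chiB1 chiB a0 ah.
  exists k, a2; split; last exact: iso.
    by rewrite inE k0 odd_quotient ?ok.
  by rewrite inE a20 a2h eqxx.
have dm : (d %| m)%N by rewrite pfactor_dvdnn.
have mkd : (d %| m - k)%N by rewrite dvdn_sub.
have mkm : (m - k < m)%N by lia.
have mk2 : (2 * (m - k) < m)%N.
  by have := dvdn_neq_half ok; lia.
have [B2 [a2 [chiB2 a20 a2h iso]]] := isotopic_opposite (ltnW km) chiB1 a0 ah.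
have [a3 [a30 a3h iso3]] :=
  isotopic_change_B (odd_order_nat mkd) chiB2 chiB a20 a2h.
exists (Ordinal mkm), a3; split.
- by rewrite inE /= odd_quotient ?subn_gt0 ?km // mkd mk2.
- by rewrite inE a30 a3h eqxx.
have [_ /(_ iso) ->] := isotopic_equivalence (mulS p m k B1 a)
  (mulS p m (m - k) B2 a2) (mulS p m (m - k) B a3).
exact: iso3.
Qed.

Lemma parameters_presemifield ka B : chi B = -1 -> ka \in parameters ->
  is_presemifield (mulS p m ka.1 B ka.2).
Proof.
move=> chiB; case: ka => k a; rewrite in_setX /= !in_set.
case/andP=> /and3P[k0 ok _] /andP[a0 /eqP ah].
by apply: mulS_presemifield => //; rewrite odd_order_nat // -odd_quotient.
Qed.

Lemma membersP op : op \in members -> exists (k : 'I_m) B a,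
  [/\ (0 < k)%N, odd (m %/ gcdn k m), chi B = -1, a \in half_units
    & op = mulS p m k B a].
Proof.
rewrite in_set => /existsP[k /existsP[B /existsP[a /and5P[k0 ok B0 nB]]]].
case/and3P=> a0; rewrite /in_half_subfield -phiE => ah /eqP opE.
exists k, B, a; split=> //; first exact: chi_nonsquare.
by rewrite in_set a0.
Qed.

(** Every member is isotopic to one with the chosen B and an exponent below m
/ 2. *)
Lemma member_classes_le : (#|member_classes| <= l./2 * (Q - 1))%N.
Proof.
have [B [chiB _]] := ex_fixed_nonsquare; rewrite -card_parameters.
pose F (ka : 'I_m * M) := class_of (mulS p m ka.1 B ka.2).
apply: leq_trans (leq_imset_card F parameters).
apply/subset_leq_card/subsetP => C.
rewrite in_set => /andP[/imsetP[op0 pop0 ->] /existsP[op /andP[opS]]].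
rewrite in_set => /andP[pop iso0].
have [k [B1 [a [k0 ok chiB1 aU opE]]]] := membersP opS.
have [k' [a' [k'P a'P iso]]] := mulS_normal_form k0 ok chiB1 chiB aU.
have kaP : (k', a') \in parameters by rewrite in_setX k'P.
apply/imsetP; exists (k', a'); first exact: kaP.
apply/eqP.
rewrite -[X in X == _]/(class_of op0) /F eq_class_of.
  have [_ /(_ iso0) ->] := isotopic_equivalence op0 op (mulS p m k' B a').
  by rewrite opE; exact: iso.
exact: (parameters_presemifield chiB kaP).
Qed.

(** Parameters in the same class share the exponent, and their second
components are related. *)
Lemma member_classes_ge : (l./2 * (Q - 1) <= 2 * m * #|member_classes|)%N.
Proof.
have [B [chiB Bfix]] := ex_fixed_nonsquare; have B0 := chiN1_neq0 chiB.
rewrite -card_parameters.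
pose F (ka : 'I_m * M) := class_of (mulS p m ka.1 B ka.2).
have semi ka := @parameters_presemifield ka B chiB.
have Fsub : F @: parameters \subset member_classes.
  apply/subsetP => _ /imsetP[[k a] kaP ->].
  rewrite in_set (class_of_classes (semi _ kaP)) /=.
  apply/existsP; exists (mulS p m k B a); apply/andP; split.
    move: kaP; rewrite in_setX => /andP[/=]; rewrite in_set => /and3P[k0 ok _].
    exact: mem_members.
  rewrite in_set; apply/andP; split; first by rewrite in_set (semi _ kaP).
  by have [-> _] := isotopic_equivalence (mulS p m k B a) (mulS p m k B a) (mulS p m k B a).
apply: leq_trans (_ : 2 * m * #|F @: parameters| <= _)%N; last first.
  by rewrite leq_mul2l subset_leq_card ?orbT.
rewrite -sum1_card (partition_big_imset F) /= mulnC -sum_nat_const.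
(* Each fibre embeds into the set of the a2 related to a. *)
apply: leq_sum => _ /imsetP[[k a] kaP ->]; rewrite sum1dep_card.
have [/= k0 ok k2 a0 ah] : [/\ (0 < k)%N, odd (m %/ gcdn k m), (2 * k < m)%N, a != 0
    & phi h a = a].
  by move: kaP; rewrite in_setX /= !in_set => /andP[/and3P[-> -> ->] /andP[-> /eqP ->]].
apply: leq_trans (card_related B0 a0 ah).
apply: leq_trans (leq_imset_card (pair k) (related B a)).
apply: subset_leq_card; apply/subsetP => -[k' a']; rewrite in_set => /andP[kaP'].
have [/= k0' ok' k2' a0' ah'] : [/\ (0 < k')%N, odd (m %/ gcdn k' m), (2 * k' < m)%N, a' != 0
    & phi h a' = a'].
  by move: kaP'; rewrite in_setX /= !in_set => /andP[/and3P[-> -> ->] /andP[-> /eqP ->]].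
rewrite eq_sym eq_class_of; last exact: (semi (k', a')).
rewrite odd_quotient // in ok; rewrite odd_quotient // in ok'.
case/isotopicP=> N [L [T [ND LD TD iso]]].
have k'0 : k'%:R != 0 :> 'Z_m by rewrite natr_Zm_neq0 // k0' ltn_ord.
have kn0 : k%:R != 0 :> 'Z_m by rewrite natr_Zm_neq0 // k0 ltn_ord.
have [|kk rel] := isotopic_parameters (odd_order_nat ok) kn0 (odd_order_nat ok') k'0
  chiB (Bfix k ok) a0 ah a0' ah' ND LD TD.
  by move=> X U; rewrite -!mulSE iso.
have kE : k' = k by apply/val_inj/natr_Zm_half_inj.
subst k'; have [t tP] := rel erefl.
apply/imsetP; exists a' => //; rewrite inE; apply/existsP; exists t.
by case: tP => ->; rewrite eqxx ?orbT.
Qed.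

End Family.

Theorem corollary6p4 (p n : nat) (M : finFieldType) :
  prime p -> odd p -> (0 < n)%N -> (4 %| n)%N -> #|M| = (p ^ (n %/ 2))%N ->
  ((odd_part n)%:R - 1) / 2 * (((p ^ (n %/ 4))%:R - 1) / n%:R)
    <= (num_S M p n)%:R :> rat
  /\ (num_S M p n)%:R
    <= ((odd_part n)%:R - 1) / 2 * ((p ^ (n %/ 4))%:R - 1) :> rat.
Proof.
move=> p_pr p_odd n0 n4 cardM; set m := (n %/ 2)%N in cardM.
have nE : n = (2 * m)%N by rewrite /m; lia.
have m_gt1 : (1 < m)%N by rewrite /m; lia.
have m_even : ~~ odd m by rewrite /m; lia.
have le := member_classes_le p_pr m_gt1 cardM p_odd m_even.
have ge := member_classes_ge p_pr m_gt1 cardM p_odd m_even.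
have -> : num_S M p n = #|member_classes M p m| by [].
have -> : (n %/ 4 = m %/ 2)%N by rewrite /m; lia.
have -> : odd_part n = odd_part m.
  rewrite /odd_part nE lognM ?(ltnW m_gt1) //.
  by rewrite (_ : logn 2 2 = 1)%N // add1n expnS divnMl.
have q0 : (0 < p ^ (m %/ 2))%N by rewrite expn_gt0 prime_gt0.
have lE : ((odd_part m)%:R - 1) / 2 = (odd_part m)./2%:R :> rat.
  have lh : odd_part m = (2 * (odd_part m)./2 + 1)%N.
    by have := odd_part_odd (ltnW m_gt1); lia.
  by rewrite {1}lh natrD natrM; field.
have -> : (p ^ (m %/ 2))%:R - 1 = (p ^ (m %/ 2) - 1)%N%:R :> rat by rewrite natrB.
rewrite lE mulrA -natrM; split; last by rewrite ler_nat.
rewrite ler_pdivrMr ?ltr0n // -natrM ler_nat.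
by apply: leq_trans ge _; rewrite nE mulnC.
Qed.
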